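(* Let $0<H<1$, $\sigma>0$, and let $W=(W_t;0\le t\le1)$ be a (continuous) fractional Brownian motion with Hurst parameter $H$ and coefficient $\sigma^2$. For almost any path $\omega$ of $W$, the tree $\mathbb{T}$ associated to $\omega$ satisfies $$\dim_H\mathbb{T}=\mathcal{V}(\omega)=1/H,$$ where $\dim_H\mathbb{T}$ is the Hausdorff dimension of the metric space $(\mathbb{T},\delta)$.
   Context: Fractional Brownian motion: centered Gaussian process with covariance $\operatorname{cov}(W_s,W_t)=\frac{\sigma^2}{2}(|s|^{2H}+|t|^{2H}-|t-s|^{2H})$. For a continuous nonconstant $\omega:[0,1]\to\mathbb{R}$, put $\delta(s,t)=\omega(s)+\omega(t)-2\inf_{[s,t]}\omega$ ($[s,t]$ denotes the interval with endpoints $s,t$). This is a semi-distance on $[0,1]$; the tree associated to $\omega$ is the quotient metric space $\mathbb{T}=([0,1]/\delta,\delta)$, which is a compact real tree. For $p\ge1$, $V_p(\omega)=\sup\sum_i|\omega(t_{i+1})-\omega(t_i)|^p$ over subdivisions $(t_i)$ of $[0,1]$, and $\mathcal{V}(\omega)=\inf\{p\ge1:V_p(\omega)<\infty\}$. *)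

(* Defs.v *)
From HB Require Import structures.
From mathcomp Require Import all_boot all_order all_algebra.
From mathcomp Require Import lra.
From mathcomp Require Import all_classical all_reals all_analysis.
Set Implicit Arguments.
Unset Strict Implicit.
Unset Printing Implicit Defensive.
Import Order.TTheory GRing.Theory Num.Theory.
Import numFieldNormedType.Exports.
Local Open Scope classical_set_scope.
Local Open Scope ring_scope.

Section fractional_brownian_motion.
Context {R : realType} {d : measure_display} {T : measurableType d}.
Variable P : probability T R.

(* [normal_prob m s] has an unrelated (uniform) density when [s = 0], hence the
   Dirac mass for degenerate Gaussian laws.  Laws are compared on Borel sets
   only: a [probability] is unconstrained outside measurable sets. *)
Definition gaussian_rv (X : T -> R) : Prop :=
  exists m s : R, forall A : set R, measurable A ->
    pushforward P X A = if s == 0 then \d_m A else normal_prob m s A.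

Definition gaussian_process (I : set R) (W : R -> {RV P >-> R}) : Prop :=
  forall (n : nat) (t a : 'I_n -> R), (forall i, I (t i)) ->
    gaussian_rv (fun x => \sum_(i < n) a i * W (t i) x).

(* Time set [0, 1]; [W t] is irrelevant for [t] outside of it. *)
Definition fractional_brownian_motion (H sigma : R) (W : R -> {RV P >-> R}) :
    Prop :=
  [/\ gaussian_process `[0, 1] W,
      forall t, t \in `[0, 1] -> ('E_P[W t] = 0)%E &
      forall s t, s \in `[0, 1] -> t \in `[0, 1] ->
        covariance P (W s) (W t) =
        (sigma ^+ 2 / 2 * (`|s| `^ (2 * H) + `|t| `^ (2 * H)
                           - `|t - s| `^ (2 * H)))%:E].

End fractional_brownian_motion.

Section p_variation.
Context {R : realType}.
Implicit Types (p : R) (w : R -> R) (s : seq R).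

Definition pvariation_sum p w s : R :=
  let F := w \o nth 1 (0 :: s) in
  \sum_(0 <= i < size s) `|F i.+1 - F i| `^ p.

Definition pvariation p w : \bar R :=
  ereal_sup [set (pvariation_sum p w s)%:E | s in itv_partition 0 1].

Definition variation_index w : \bar R :=
  ereal_inf [set p%:E | p in [set p | 1 <= p /\ (pvariation p w < +oo)%E]].

End p_variation.

Section hausdorff_dimension.
Context {R : realType} {M : metricType R}.
Implicit Types (s e : R) (A B : set M) (U : nat -> set M).

Definition diameter A : \bar R :=
  ereal_sup [set (mdist x y)%:E | x in A & y in A].

(* diam(B)^s, with the value 0 on the empty set and 0^0 = 1 otherwise, so that
   the 0-dimensional Hausdorff measure is the counting measure. *)
Definition hausdorff_gauge s B : \bar R :=
  if B == set0 then 0%E else poweR (diameter B) s.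

Definition hausdorff_content s e A : \bar R :=
  ereal_inf [set (\sum_(i <oo) hausdorff_gauge s (U i))%E | U in
    [set U | A `<=` \bigcup_i U i /\ forall i, (diameter (U i) <= e%:E)%E]].

Definition hausdorff_measure s A : \bar R :=
  ereal_sup [set hausdorff_content s e A | e in [set e | 0 < e]].

Definition hausdorff_dim A : \bar R :=
  ereal_inf [set s%:E | s in [set s | 0 <= s /\ hausdorff_measure s A = 0%E]].

End hausdorff_dimension.

Definition unit_itv (R : realType) := {t : R | t \in `[0, 1]}.

Section tree_semidistance.
Context {R : realType}.
Variable w : R -> R.

Definition tree_semidist (s t : R) : R :=
  w s + w t - 2 * inf (w @` `[Num.min s t, Num.max s t]).

Lemma tree_semidistC s t : tree_semidist s t = tree_semidist t s.
Proof. by rewrite /tree_semidist minC maxC (addrC (w s)). Qed.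

Lemma tree_semidistxx t : tree_semidist t t = 0.
Proof.
rewrite /tree_semidist minxx maxxx set_itv1 image_set1 inf1.
by rewrite mulrDl mul1r subrr.
Qed.

Hypothesis wc : {within `[0, 1], continuous w}.

Let has_lbound_path s t : s \in `[0, 1] -> t \in `[0, 1] ->
  has_lbound (w @` `[Num.min s t, Num.max s t]).
Proof.
rewrite !in_itv/= => /andP[s0 s1] /andP[t0 t1].
have [c c01 wcle] := EVT_min ler01 wc.
exists (w c) => _ [u /= + <-]; rewrite in_itv/= => /andP[su ut].
apply: wcle; rewrite in_itv/= (le_trans _ su) ?(le_trans ut)//.
- by rewrite ge_max s1.
- by rewrite le_min s0.
Qed.

Let inf_le s t u : s \in `[0, 1] -> t \in `[0, 1] ->
  Num.min s t <= u -> u <= Num.max s t ->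
  inf (w @` `[Num.min s t, Num.max s t]) <= w u.
Proof.
move=> s01 t01 su ut; apply: ge_inf; first exact: has_lbound_path.
by exists u => //=; rewrite in_itv/= su.
Qed.

Lemma tree_semidist_triangle y x z :
  x \in `[0, 1] -> y \in `[0, 1] -> z \in `[0, 1] ->
  tree_semidist x z <= tree_semidist x y + tree_semidist y z.
Proof.
move=> x01 y01 z01; rewrite /tree_semidist.
set a := inf _; set b := inf _; set c := inf _.
have bwy : b <= w y by apply: inf_le => //; rewrite ?ge_min ?le_max lexx orbT.
have cwy : c <= w y by apply: inf_le => //; rewrite ?ge_min ?le_max lexx.
suff : b + c - w y <= a.
  by move=> h; lra.
apply: lb_le_inf.
  exists (w x), x => //=; rewrite in_itv/= ge_min le_max.
  by rewrite lexx.
move=> _ [u /= + <-]; rewrite in_itv/= => /andP[xzu uxz].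
have [[h1 h2]|[h1 h2]] : (Num.min x y <= u /\ u <= Num.max x y) \/
    (Num.min y z <= u /\ u <= Num.max y z).
  move: xzu uxz; rewrite !ge_min !le_max.
  have [yu _ /orP[ux|uz]|/ltW uy /orP[xu|zu] _] := leP y u.
  - by left; rewrite ux ?yu ?orbT.
  - by right; rewrite uz ?yu ?orbT.
  - by left; rewrite xu ?uy ?orbT.
  - by right; rewrite zu ?uy ?orbT.
- have : b <= w u by exact: inf_le.
  lra.
- have : c <= w u by exact: inf_le.
  lra.
Qed.

Lemma tree_semidist_ge0 s t : s \in `[0, 1] -> t \in `[0, 1] ->
  0 <= tree_semidist s t.
Proof.
move=> s01 t01; have := tree_semidist_triangle s01 t01 s01.
by rewrite tree_semidistxx (tree_semidistC t); lra.
Qed.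

Lemma tree_semidist_congr s s' t t' :
  s \in `[0, 1] -> s' \in `[0, 1] -> t \in `[0, 1] -> t' \in `[0, 1] ->
  tree_semidist s' s = 0 -> tree_semidist t' t = 0 ->
  tree_semidist s' t' = tree_semidist s t.
Proof.
move=> s01 s'01 t01 t'01 ds dt; apply/le_anti/andP; split.
- have := tree_semidist_triangle s'01 s01 t'01.
  have := tree_semidist_triangle s01 t01 t'01.
  by rewrite ds (tree_semidistC t t') dt; lra.
- have := tree_semidist_triangle s01 s'01 t01.
  have := tree_semidist_triangle s'01 t'01 t01.
  by rewrite dt (tree_semidistC s s') ds; lra.
Qed.

Definition tree_rel (s t : unit_itv R) : bool :=
  tree_semidist (val s) (val t) == 0.

Lemma tree_rel_refl : reflexive tree_rel.
Proof. by move=> t; rewrite /tree_rel tree_semidistxx. Qed.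

Lemma tree_rel_sym : symmetric tree_rel.
Proof. by move=> s t; rewrite /tree_rel tree_semidistC. Qed.

Lemma tree_rel_trans : transitive tree_rel.
Proof.
move=> y x z /eqP xy /eqP yz; apply/eqP/le_anti.
rewrite tree_semidist_ge0 ?(valP x) ?(valP z)// andbT.
by rewrite (le_trans (tree_semidist_triangle (valP x) (valP y) (valP z)))//
  xy yz addr0.
Qed.

Definition tree_equiv := EquivRel _ tree_rel_refl tree_rel_sym tree_rel_trans.

End tree_semidistance.

Section tree.
Local Open Scope quotient_scope.
Context {R : realType} {w : R -> R} (wc : {within `[0, 1], continuous w}).

Definition tree := {eq_quot (tree_equiv wc)}.
HB.instance Definition _ := Choice.on tree.
HB.instance Definition _ := Quotient.on tree.

Definition tree_dist (x y : tree) : R :=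
  tree_semidist w (val (repr x)) (val (repr y)).

Let tree_distxx x : tree_dist x x = 0.
Proof. exact: tree_semidistxx. Qed.

Let tree_dist_positivity x y : tree_dist x y = 0 -> x = y.
Proof.
move=> /eqP xy; rewrite -[x]reprK -[y]reprK.
exact/(eqmodP (tree_equiv wc)).
Qed.

Let tree_dist_sym x y : tree_dist x y = tree_dist y x.
Proof. exact: tree_semidistC. Qed.

Let tree_dist_triangle y x z : tree_dist x z <= tree_dist x y + tree_dist y z.
Proof. by apply: tree_semidist_triangle => //; exact: valP. Qed.

HB.instance Definition _ := @isMetric.Build R tree tree_dist
  tree_distxx tree_dist_positivity tree_dist_sym tree_dist_triangle.

Lemma mdist_tree_pi (s t : unit_itv R) :
  mdist (\pi_tree s) (\pi_tree t) = tree_semidist w (val s) (val t).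
Proof.
have h (u : unit_itv R) : tree_semidist w (val (repr (\pi_tree u))) (val u) = 0.
  apply/eqP/(eqmodP (tree_equiv wc)); exact: reprK.
by apply: (tree_semidist_congr wc); rewrite ?h//; exact: valP.
Qed.

End tree.

(* Main.v *)
(** The chain 1/H <= dim_H T <= V(w) <= 1/H holds almost surely.

  dim_H T <= V(w) is deterministic: when V_p(w) is finite, phi(t) = V_p(w; [0, t])
  satisfies |w(t) - w(s)|^p <= phi(t) - phi(s), so slicing [0, 1] into n pieces
  along the values of phi gives n sets of diameter O(n^(-1/p)) that cover T.
  V(w) <= 1/H is Kolmogorov's theorem: exponential Gaussian tails and dyadic
  chaining make the paths alpha-Hoelder for every alpha < H.

  For 1/H <= dim_H T, put u_j = 2^-j.  The variables W(s + u_j) - W(s),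
  normalized to variance 1, have exponentially decaying correlations;
  Chebyshev's inequality for the sum of their exponentials shows that for m
  consecutive scales none of them is below -1/4 with probability O(1/m) only.
  Borel-Cantelli and Fubini yield a set G of times of positive Lebesgue measure
  at which w soon drops from w(s) by nearly h^H at every small scale h.  If w has
  dropped by more than r between s and t, then delta(s, t) > r; hence
  t - s <= C delta(s, t)^gamma on G for every gamma < 1/H, and a cover of T by sets
  of small total diam^gamma would produce a cover of G of small Lebesgue measure. *)

Require Import Defs.
From HB Require Import structures.
From mathcomp Require Import all_boot all_order all_algebra.
From mathcomp Require Import ring lra zify.
From mathcomp Require Import all_classical all_reals all_analysis.
From mathcomp Require Import measurable_realfun.
Import Order.TTheory GRing.Theory Num.Theory.
Import numFieldNormedType.Exports.
Local Open Scope classical_set_scope.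
Local Open Scope ring_scope.

Set Implicit Arguments.
Unset Strict Implicit.
Unset Printing Implicit Defensive.

(** * Hausdorff dimension of the tree: upper bound by p-variation *)

(** A Gaussian process is only known to give each linear combination some normal law, not yet tied
    to its mean and variance. This is settled once, through exponential moments; afterwards
    Gaussianity enters only as the exponential moment of two increments from a common time. Hence
    the exponentials in the second moment argument: their covariances are explicit in the
    correlation, so no joint density is needed. The lower bound works with descents because a drop
    after [s] stays in the infimum over [[s, t]], whereas a rise may be undone before [t]. Across
    [l] dyadic scales the correlation is O(max(2^-H, 2^(H-1))^l), and this is where 0 < H < 1
    matters. As 1/m is not summable, the persistence bound is used on windows of scales from [a m]
    to [(a+1) m] with [m] quadratic in an index. A drop somewhere in a window is measured against
    the finest scale of the window; this costs a factor (a+1)/a in the exponent, which tends to 1 as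
    [a] grows. *)

Section tree_bounds.
Context {R : realType}.
Variable w : R -> R.
Hypothesis wc : {within `[0, 1], continuous w}.
Implicit Types s t u e : R.

Lemma path_has_lbound s t : 0 <= s -> t <= 1 -> has_lbound (w @` `[s, t]).
Proof.
move=> s0 t1; have [c c01 wcle] := EVT_min ler01 wc.
exists (w c) => _ [u /= + <-]; rewrite in_itv/= => /andP[su ut].
by apply: wcle; rewrite in_itv/= (le_trans s0 su) (le_trans ut t1).
Qed.

(** Each value of [w] on [[s, t]] is at least [w s - e] and at least [w t - e], hence at least the
    mean of the two. *)
Lemma tree_semidist_le s t e : s <= t ->
  (forall u, s <= u <= t -> `|w u - w s| <= e /\ `|w t - w u| <= e) ->
  tree_semidist w s t <= 2 * e.
Proof.
move=> st h; rewrite /tree_semidist (min_idPl st) (max_idPr st).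
have : (w s + w t) / 2 - e <= inf (w @` `[s, t]); last by lra.
apply: lb_le_inf; first by exists (w s), s => //=; rewrite in_itv/= lexx.
move=> _ [u /= + <-]; rewrite in_itv/= => /h[].
by rewrite !ler_norml => /andP[? ?] /andP[? ?]; lra.
Qed.

(** The infimum is at most [w u] and at most [w t]. A descent from [w s] at one intermediate time
    thus bounds the distance below, whatever the path does afterwards. *)
Lemma tree_semidist_ge s t u : 0 <= s -> t <= 1 -> s <= u <= t ->
  w s - w u <= tree_semidist w s t.
Proof.
move=> s0 t1 /andP[su ut]; have st := le_trans su ut.
rewrite /tree_semidist (min_idPl st) (max_idPr st).
have lb := path_has_lbound s0 t1.
have := ge_inf lb; move=> h.
have : inf (w @` `[s, t]) <= w u.
  by apply: h; exists u => //=; rewrite in_itv/= su.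
have : inf (w @` `[s, t]) <= w t.
  by apply: h; exists t => //=; rewrite in_itv/= st lexx.
lra.
Qed.

End tree_bounds.

Section hausdorff_upper.
Context {R : realType} {M : metricType R}.
Implicit Types (U : nat -> set M) (A : set M).

Lemma hausdorff_gauge_ge0 q A : (0 <= hausdorff_gauge q A)%E.
Proof. by rewrite /hausdorff_gauge; case: ifP => // _; exact: poweR_ge0. Qed.

Lemma hausdorff_content_ge0 q e A : (0 <= hausdorff_content q e A)%E.
Proof.
apply/ereal_infP => _ [U _ <-].
by apply: nneseries_ge0 => n _ _; exact: hausdorff_gauge_ge0.
Qed.

Lemma diameter_ge0 A : A !=set0 -> (0 <= diameter A)%E.
Proof.
move=> [x Ax]; apply: le_ereal_sup_tmp; exists 0%E => //.
by exists x => //; exists x => //; rewrite mdistxx.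
Qed.

Lemma hausdorff_gauge_le q A (r : R) : 0 <= q -> 0 <= r ->
  (diameter A <= r%:E)%E -> (hausdorff_gauge q A <= (r `^ q)%:E)%E.
Proof.
move=> q0 r0 Ar; rewrite /hausdorff_gauge; case: ifPn => [_|/set0P A0].
  by rewrite lee_fin powR_ge0.
rewrite -poweR_EFin; apply: gt0_ler_poweR => //; rewrite in_itv/= leey andbT.
- exact: diameter_ge0.
- by rewrite lee_fin.
Qed.

(** Covers are sequences, so the finite cover is padded with [set0], whose gauge is 0 for every [q],
    including [q = 0]. *)
Lemma hausdorff_content_le_finite q e A (r : R) n U : 0 <= q -> 0 <= r ->
  r <= e -> A `<=` \bigcup_(i in `I_n) U i ->
  (forall i, (i < n)%N -> (diameter (U i) <= r%:E)%E) ->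
  (hausdorff_content q e A <= (n%:R * r `^ q)%:E)%E.
Proof.
move=> q0 r0 re AU dU.
pose V i := if (i < n)%N then U i else set0.
have dV i : (diameter (V i) <= r%:E)%E.
  rewrite /V; case: ifPn => [|_]; first exact: dU.
  by apply: ge_ereal_sup => _ [? []].
apply: ge_ereal_inf; exists (\sum_(i <oo) hausdorff_gauge q (V i))%E.
  exists V => //; split.
    by move=> x /AU[i /= ni Uix]; exists i => //; rewrite /V ni.
  by move=> i; rewrite (le_trans (dV i))// lee_fin.
rewrite (nneseries_split 0 n); last by move=> *; exact: hausdorff_gauge_ge0.
rewrite eseries0 ?adde0; last first.
  by move=> i; rewrite add0n leqNgt /V => /negbTE -> _; rewrite /hausdorff_gauge eqxx.
rewrite add0n big_mkord (@le_trans _ _ (\sum_(i < n) (r `^ q)%:E)%E)//.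
  by apply: lee_sum => i _; exact: hausdorff_gauge_le.
by rewrite sumEFin sumr_const card_ord mulr_natl.
Qed.

Lemma hausdorff_measure_eq0 q A :
  (forall e eta, 0 < e -> 0 < eta -> (hausdorff_content q e A <= eta%:E)%E) ->
  hausdorff_measure q A = 0%E.
Proof.
move=> h; apply/eqP; rewrite eq_le; apply/andP; split.
  apply: ge_ereal_sup => _ [e /= e0 <-].
  apply/lee_addgt0Pr => eta eta0; rewrite add0e; exact: h.
apply: le_ereal_sup_tmp; exists (hausdorff_content q 1 A).
  by exists 1 => //=.
exact: hausdorff_content_ge0.
Qed.

Lemma hausdorff_dim_le q A : 0 <= q -> hausdorff_measure q A = 0%E ->
  (hausdorff_dim A <= q%:E)%E.
Proof. by move=> q0 h; apply: ge_ereal_inf; exists q%:E => //; exists q. Qed.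

End hausdorff_upper.

Section real_powers.
Context {R : realType}.

Lemma powR2N_lt1 (a : R) : 0 < a -> 2 `^ (- a) < 1 :> R.
Proof.
move=> a0; rewrite powRN invf_lt1 ?powR_gt0//.
have : 1 `^ a < 2 `^ a :> R by apply: gt0_ltr_powR; rewrite ?nnegrE// ltr1n.
by rewrite powR1.
Qed.

Lemma exists_natr_powR_le (b eta : R) : 0 < b -> 0 < eta ->
  exists n : nat, forall k : nat, (n <= k)%N -> (k.+1)%:R `^ (- b) <= eta.
Proof.
move=> b0 eta0; have [n Hn] : exists n : nat, eta `^ (- b^-1) <= n%:R.
  exists (Num.bound (eta `^ (- b^-1))).
  by apply/ltW/archi_boundP; rewrite powR_ge0.
exists n => k nk.
have h : eta `^ (- b^-1) <= k.+1%:R.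
  by rewrite (le_trans Hn)// ler_nat (leq_trans nk).
rewrite powRN -[leRHS]invrK lef_pV2 ?posrE ?invr_gt0 ?powR_gt0//.
have -> : eta^-1 = (eta `^ (- b^-1)) `^ b.
  by rewrite -powRrM mulNr mulVf ?gt_eqF// powRN powRr1// ltW.
by apply: ge0_ler_powR; rewrite ?nnegrE ?powR_ge0// ltW.
Qed.

End real_powers.

Section tree_upper.
Context {R : realType}.
Variable w : R -> R.
Hypothesis wc : {within `[0, 1], continuous w}.

Lemma powR_root_le (a b p : R) : 0 < p -> 0 <= a -> 0 <= b ->
  a `^ p <= b -> a <= b `^ p^-1.
Proof.
move=> p0 a0 b0 ab; rewrite -[leLHS](powRr1 a0) -(@mulfV _ p) ?gt_eqF//.
by rewrite powRrM; apply: ge0_ler_powR; rewrite ?nnegrE ?powR_ge0// invr_ge0 ltW.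
Qed.

(* Cover by the level sets [i L / n <= phi < (i + 1) L / n], on which the
   oscillation of [w] is at most [(L / n) ^ (1 / p)]. *)
Lemma tree_dim_le_control (p K : R) (phi : R -> R) : 0 < p ->
  (forall t, 0 <= t <= 1 -> 0 <= phi t <= K) ->
  (forall s t, 0 <= s -> s <= t -> t <= 1 ->
     `|w t - w s| `^ p <= phi t - phi s) ->
  (hausdorff_dim [set: tree wc] <= p%:E)%E.
Proof.
move=> p0 phiK wphi; apply/lee_addgt0Pr => eps eps0.
have pe0 : 0 < p + eps by lra.
rewrite -EFinD; apply: hausdorff_dim_le; first exact: ltW.
apply: hausdorff_measure_eq0 => e eta e0 eta0.
have K0 : 0 < K + 1 by have := @phiK 0; rewrite lexx ler01 => /(_ isT); lra.
(* With [K + 1] in place of [K], the length is positive and [phi < L] is strict, so that the [n.+1]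
   half-open levels suffice. *)
set L := K + 1 in K0 *.
have Lp : 0 < L `^ p^-1 by rewrite powR_gt0.
(* [n1] makes the diameters at most [e]. [n2] makes the total gauge at most [eta]: up to a constant
   it is [n.+1 * n.+1^(-(p + eps)/p) = n.+1^(-eps/p)]. *)
have [n1 Hn1] := @exists_natr_powR_le R p^-1 (e / 2 / L `^ p^-1)
  ltac:(by rewrite invr_gt0) ltac:(by rewrite !divr_gt0).
have [n2 Hn2] := @exists_natr_powR_le R (eps / p)
  (eta / (2 * L `^ p^-1) `^ (p + eps))
  ltac:(by rewrite divr_gt0) ltac:(by rewrite divr_gt0 ?powR_gt0 ?mulr_gt0).
pose n := maxn n1 n2.
have {}Hn1 := Hn1 n (leq_maxl _ _); have {}Hn2 := Hn2 n (leq_maxr _ _).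
have n0 : 0 < n.+1%:R :> R by rewrite ltr0n.
pose r := 2 * L `^ p^-1 * n.+1%:R `^ (- p^-1).
have r0 : 0 <= r by rewrite !mulr_ge0 ?powR_ge0.
have re : r <= e.
  rewrite /r -mulrA -ler_pdivlMl// mulrC -ler_pdivlMr// (le_trans Hn1)//.
  by rewrite (mulrC e).
pose U (i : nat) : set (tree wc) :=
  [set x : tree wc | i%:R <= phi (val (repr x)) * n.+1%:R / L < i.+1%:R].
apply: (@le_trans _ _ (n.+1%:R * r `^ (p + eps))%:E); last first.
  rewrite lee_fin /r powRM ?powR_ge0 ?mulr_ge0 ?powR_ge0//.
  rewrite mulrCA mulrC -ler_pdivlMr ?powR_gt0 ?mulr_gt0//.
  rewrite (le_trans _ Hn2)// -powRrM -[X in X * _]powRr1 ?(ltW n0)//.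
  rewrite -powRD ?(gt_eqF n0) ?implybT//.
  suff -> : 1 + - p^-1 * (p + eps) = - (eps / p) by [].
  by field; rewrite gt_eqF.
apply: (@hausdorff_content_le_finite _ _ _ _ _ _ _ U) => //; first exact: ltW.
  move=> x _; set a := phi (val (repr x)) * n.+1%:R / L.
  have /phiK/andP[f0 fK] : 0 <= val (repr x) <= 1.
    by have := valP (repr x); rewrite in_itv.
  have a0 : 0 <= a by rewrite divr_ge0 ?mulr_ge0// ltW.
  have an : a < n.+1%:R.
    by rewrite /a ltr_pdivrMr// mulrC ltr_pM2l// /L; lra.
  have /andP[h1 h2] := truncn_itv a0.
  exists (Num.truncn a); last by rewrite /U /= -/a h1 h2.
  by rewrite /= -(ltr_nat R) (le_lt_trans h1).
move=> i _; apply: ge_ereal_sup => _ [x Ux [y Uy <-]]; rewrite lee_fin.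
have xb : 0 <= val (repr x) <= 1 by have := valP (repr x); rewrite in_itv.
have yb : 0 <= val (repr y) <= 1 by have := valP (repr y); rewrite in_itv.
change (tree_semidist w (val (repr x)) (val (repr y)) <= r).
have key s t : 0 <= s -> s <= t -> t <= 1 ->
    i%:R <= phi s * n.+1%:R / L -> phi t * n.+1%:R / L < i.+1%:R ->
    tree_semidist w s t <= r.
  move=> s0 st t1 hs ht; rewrite /r -mulrA.
  have -> : L `^ p^-1 * n.+1%:R `^ (- p^-1) = (L / n.+1%:R) `^ p^-1.
    by rewrite powRM ?ltW ?invr_gt0 // -(powR_inv1 (ltW n0)) -powRrM mulN1r.
  have d : phi t - phi s <= L / n.+1%:R.
    rewrite ler_pdivlMr//.
    have : phi t * n.+1%:R < i.+1%:R * L by rewrite -ltr_pdivrMr.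
    have : i%:R * L <= phi s * n.+1%:R by rewrite -ler_pdivlMr.
    by rewrite -[i.+1%:R]natr1; lra.
  apply: tree_semidist_le => // u /andP[su ut].
  have h1 := wphi _ _ s0 su (le_trans ut t1).
  have h2 := wphi _ _ (le_trans s0 su) ut t1.
  have h3 := powR_ge0 `|w u - w s| p.
  have h4 := powR_ge0 `|w t - w u| p.
  have Ln : 0 <= L / n.+1%:R by rewrite divr_ge0 // ltW.
  by split; apply: powR_root_le => //; apply: le_trans d; lra.
move: Ux Uy => /andP[x1 x2] /andP[y1 y2].
move: xb yb => /andP[? ?] /andP[? ?].
have [xy|/ltW yx] := leP (val (repr x)) (val (repr y)).
  exact: key.
by rewrite tree_semidistC; exact: key.
Qed.

End tree_upper.

Section p_variation_bounds.
Context {R : realType}.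
Variable w : R -> R.
Implicit Types (p : R) (s : seq R).

Lemma pvariation_sum_rcons p s t :
  pvariation_sum p w (rcons s t) =
  pvariation_sum p w s + `|w t - w (last 0 s)| `^ p.
Proof.
rewrite /pvariation_sum size_rcons big_nat_recr//=; congr +%R.
  rewrite [LHS]big_nat [RHS]big_nat; apply: eq_bigr => i /andP[_ is_].
  by rewrite -rcons_cons !nth_rcons/= is_ !ltnS ltnW.
rewrite -rcons_cons !nth_rcons/= ltnn eqxx ltnSn.
by rewrite (last_nth 1).
Qed.

Lemma itv_partition_rcons s (a b t : R) : itv_partition a b s -> b < t ->
  itv_partition a t (rcons s t).
Proof.
move=> [sp /eqP sl] bt; split; last by rewrite last_rcons.
by rewrite rcons_path sp sl.
Qed.

(** Appending the endpoint 1 adds a nonnegative term; the case [t = 1] is apart because partitions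
    increase strictly. *)
Lemma pvariation_sum_le_pvariation p s t : itv_partition 0 t s -> t <= 1 ->
  ((pvariation_sum p w s)%:E <= pvariation p w)%E.
Proof.
move=> ps; rewrite le_eqVlt => /orP[/eqP t1|t1].
  by apply: ereal_sup_ubound; exists s => //; rewrite -t1.
apply: le_ereal_sup_tmp; exists (pvariation_sum p w (rcons s 1))%:E.
  by exists (rcons s 1) => //; exact: itv_partition_rcons t1.
by rewrite lee_fin pvariation_sum_rcons lerDl powR_ge0.
Qed.

Lemma itv_partition0 t : 0 <= t -> exists s, itv_partition 0 t s.
Proof.
rewrite le_eqVlt => /orP[/eqP <-|t0]; first by exists [::].
by exists [:: t]; exact: itv_partition1.
Qed.

Lemma pvariation_sum_ge0 p s : 0 <= pvariation_sum p w s.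
Proof. by apply: sumr_ge0 => i _; exact: powR_ge0. Qed.

Lemma pvariation_holder (C al : R) : 0 <= C -> 0 < al ->
  (forall u v, 0 <= u -> u <= v -> v <= 1 -> `|w v - w u| <= C * (v - u) `^ al) ->
  (pvariation al^-1 w < +oo)%E.
Proof.
move=> C0 al0 h; apply: (@le_lt_trans _ _ (C `^ al^-1)%:E); last exact: ltry.
apply: ge_ereal_sup => _ [s ps <-]; rewrite lee_fin.
(* The endpoint is generalized so that the induction can remove the last point; each step
   contributes at most [C^(1/al)] times its length. *)
suff {ps} : forall t, itv_partition 0 t s -> t <= 1 ->
    pvariation_sum al^-1 w s <= C `^ al^-1 * t.
  by move=> /(_ 1 ps (lexx _)); rewrite mulr1.
elim/last_ind: s => [t [_ /eqP/= <-] _|s x IH t [+ /eqP]].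
  by rewrite mulr0 /pvariation_sum big_nil.
rewrite last_rcons rcons_path => /andP[sp sx] <- x1.
rewrite pvariation_sum_rcons.
have IH1 := IH (last 0 s) (conj sp (eqxx _)) (le_trans (ltW sx) x1).
have l0 := @itv_partition_le _ _ 0 _ s (conj sp (eqxx _)).
rewrite (le_trans (lerD IH1 (lexx _)))//.
have : `|w x - w (last 0 s)| `^ al^-1 <= C `^ al^-1 * (x - last 0 s).
  have x0 : 0 <= x - last 0 s by rewrite subr_ge0 ltW.
  have -> : x - last 0 s = ((x - last 0 s) `^ al) `^ al^-1.
    by rewrite -powRrM mulfV ?gt_eqF// powRr1.
  rewrite -powRM ?powR_ge0//.
  apply: ge0_ler_powR; rewrite ?nnegrE ?mulr_ge0 ?powR_ge0 ?invr_ge0 ?(ltW al0)//.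
  exact: h (ltW sx) x1.
by set a := _ `^ al^-1; set b := _ `^ al^-1; lra.
Qed.

Hypothesis wc : {within `[0, 1], continuous w}.

(** The control function at [t] is the supremum over partitions of [[0, t]]. Its increments dominate
    because a partition of [[0, s]] followed by [t] is a partition of [[0, t]] with the extra term
    [|w t - w s|^p]. *)
Lemma tree_dim_le_pvariation p : 0 < p -> (pvariation p w < +oo)%E ->
  (hausdorff_dim [set: tree wc] <= p%:E)%E.
Proof.
move=> p0 pw.
pose S t := [set pvariation_sum p w s | s in itv_partition 0 t].
have pv0 : (0 <= pvariation p w)%E.
  have [s ps] := @itv_partition0 1 ler01.
  apply: le_trans (pvariation_sum_le_pvariation p ps (lexx _)).
  by rewrite lee_fin pvariation_sum_ge0.
have SK t x : t <= 1 -> S t x -> x <= fine (pvariation p w).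
  move=> t1 [s ps <-]; rewrite -lee_fin fineK ?ge0_fin_numE//.
  exact: pvariation_sum_le_pvariation ps t1.
have Sub t : t <= 1 -> has_ubound (S t).
  by move=> t1; exists (fine (pvariation p w)) => x; exact: SK.
have Sne t : 0 <= t -> S t !=set0.
  by move=> /itv_partition0[s ps]; exists (pvariation_sum p w s), s.
apply: (@tree_dim_le_control _ _ wc p (fine (pvariation p w)) (fun t => sup (S t))) => //.
  move=> t /andP[t0 t1]; apply/andP; split; last first.
    by apply: ge_sup; [exact: Sne|move=> x; exact: SK].
  have [x Sx] := Sne _ t0; apply: (@le_trans _ _ x).
    by case: Sx => s _ <-; exact: pvariation_sum_ge0.
  by apply: ub_le_sup => //; exact: Sub.
move=> s t s0; rewrite le_eqVlt => /orP[/eqP <-|st] t1.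
  by rewrite !subrr normr0 powR0 ?gt_eqF.
suff : sup (S s) <= sup (S t) - `|w t - w s| `^ p by lra.
apply: ge_sup; first exact: Sne.
move=> _ [l pl <-]; rewrite lerBrDr.
have /eqP ls : last 0 l == s by case: pl.
rewrite -[in w s]ls -pvariation_sum_rcons.
apply: ub_le_sup; first exact: Sub.
by exists (rcons l t) => //; exact: itv_partition_rcons pl st.
Qed.

Lemma tree_dim_le_variation_index :
  (hausdorff_dim [set: tree wc] <= variation_index w)%E.
Proof.
apply/ereal_infP => _ [p /= [p1 pv] <-].
by apply: tree_dim_le_pvariation => //; exact: lt_le_trans p1.
Qed.

Lemma variation_index_holder (C al : R) : 0 <= C -> 0 < al -> al <= 1 ->
  (forall u v, 0 <= u -> u <= v -> v <= 1 -> `|w v - w u| <= C * (v - u) `^ al) ->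
  (variation_index w <= (al^-1)%:E)%E.
Proof.
move=> C0 al0 al1 h; apply: ge_ereal_inf; exists (al^-1)%:E => //.
exists al^-1 => //=; split; first by rewrite invf_ge1.
exact: pvariation_holder h.
Qed.

End p_variation_bounds.

(** * Hausdorff dimension of the tree: lower bound *)

Section hausdorff_lower.
Context {R : realType}.
Variable w : R -> R.
Hypothesis wc : {within `[0, 1], continuous w}.

(** A mass distribution argument carried out on times: the points of [G] that project into a set of
    diameter [d] lie in an interval of length [C d^gam], so a cover of the tree yields a cover of
    [G] by intervals. *)
Lemma tree_dim_ge (G : set R) (gam C r0 : R) : 0 < gam -> 0 < C -> 0 < r0 ->
  measurable G -> G `<=` `[0, 1] -> (0 < lebesgue_measure G)%E ->
  (forall s t, G s -> G t -> s < t -> tree_semidist w s t < r0 ->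
     t - s <= C * tree_semidist w s t `^ gam) ->
  (gam%:E <= hausdorff_dim [set: tree wc])%E.
Proof.
move=> gam0 C0 r00 mG G01 G0 hG.
apply/ereal_infP => _ [q /= [q0 Hq] <-]; rewrite lee_fin leNgt; apply/negP => qg.
(* Diameters at most 1 give [d^gam <= d^q] for [q < gam]; diameters below [r0] make the hypothesis
   on [G] applicable. *)
pose e := Num.min 1 (r0 / 2).
have e0 : 0 < e by rewrite lt_min ltr01/= divr_gt0.
have e1 : e <= 1 by rewrite ge_min lexx.
have er0 : e < r0 by apply: (@le_lt_trans _ _ (r0 / 2)); [rewrite ge_min lexx orbT|lra].
have muG : (lebesgue_measure G \is a fin_num)%E.
  rewrite ge0_fin_numE//; apply: (@le_lt_trans _ _ (lebesgue_measure `[0%R, 1%R]%classic)).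
    by apply: le_measure; rewrite ?inE.
  by rewrite lebesgue_measure_itv/= lte01 oppr0 adde0 ltry.
pose m := fine (lebesgue_measure G).
have m0 : 0 < m by rewrite -lte_fin fineK.
have : (hausdorff_content q e [set: tree wc] <= 0)%E.
  by rewrite -Hq; apply: ereal_sup_ubound; exists e.
(* The intervals will have total length below [C * eta = m / 2], half the measure of [G]. *)
pose eta := m / (2 * C).
have eta0 : 0 < eta by rewrite divr_gt0 ?mulr_gt0.
rewrite leNgt => /negP; apply.
rewrite (@lt_le_trans _ _ eta%:E)// leNgt; apply/negP.
move=> /ereal_inf_lt[_ [U [cov dU] <-]].
pose g i := hausdorff_gauge q (U i).
move=> geta.
pose A i := [set s | G s /\ exists h : s \in `[0, 1], U i (\pi_(tree wc) (exist _ s h))]%qT.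
pose d i := fine (diameter (U i)).
pose ell i := C * d i `^ gam.
(* [A i] is not known to be measurable; it is replaced by an interval of the same diameter bound. *)
pose F i := if U i == set0 then set0 else `[inf (A i), inf (A i) + ell i]%classic.
have AF i : A i `<=` F i.
  rewrite /F; case: ifPn => [/eqP U0 s [_ [h]]|/set0P U0]; first by rewrite U0.
  have dfin : diameter (U i) \is a fin_num.
    by rewrite ge0_fin_numE ?diameter_ge0// (le_lt_trans (dU i))// ltry.
  have de : d i <= e by rewrite -lee_fin fineK.
  have As s t : A i s -> A i t -> s <= t -> t - s <= ell i.
    move=> [Gs [hs Us]] [Gt [ht Ut]].
    rewrite le_eqVlt => /orP[/eqP<-|st].
      by rewrite subrr mulr_ge0 ?powR_ge0// ltW.
    have st_d : tree_semidist w s t <= d i.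
      rewrite -lee_fin fineK//; apply: ereal_sup_ubound.
      exists (\pi_(tree wc) (exist _ s hs))%qT => //.
      exists (\pi_(tree wc) (exist _ t ht))%qT => //.
      by rewrite mdist_tree_pi.
    rewrite (le_trans (hG _ _ Gs Gt st _))//.
      by rewrite (le_lt_trans st_d)// (le_lt_trans de).
    rewrite ler_pM2l//; apply: ge0_ler_powR; rewrite ?nnegrE ?(ltW gam0)//.
      exact: (tree_semidist_ge0 wc).
    by rewrite (le_trans _ st_d)//; exact: (tree_semidist_ge0 wc).
  move=> s Ais; rewrite /= in_itv/=; apply/andP; split.
    apply: ge_inf => //; exists 0 => x [/G01 + _]; rewrite /= in_itv/=.
    by case/andP.
  rewrite -lerBlDr; apply: lb_le_inf; first by exists s.
  move=> x Aix; rewrite lerBlDr -lerBlDl.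
  have [xs|/ltW sx] := leP x s; first exact: As.
  rewrite (@le_trans _ _ 0)//; first by rewrite subr_le0.
  by rewrite mulr_ge0 ?powR_ge0// ltW.
have mF i : measurable (F i) by rewrite /F; case: ifP.
have Fg i : (lebesgue_measure (F i) <= C%:E * g i)%E.
  rewrite /F; case: ifPn => [U0|U0].
    by rewrite measure0 mule_ge0 ?hausdorff_gauge_ge0// lee_fin ltW.
  rewrite /g /hausdorff_gauge (negbTE U0); move/set0P in U0.
  have dfin : diameter (U i) \is a fin_num.
    by rewrite ge0_fin_numE ?diameter_ge0// (le_lt_trans (dU i))// ltry.
  have de : d i <= e by rewrite -lee_fin fineK.
  have d0 : 0 <= d i by rewrite -lee_fin fineK// diameter_ge0.
  rewrite -(fineK dfin) poweR_EFin -EFinM -/(d i).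
  rewrite lebesgue_measure_itv/=; case: ifPn => _; last first.
    by rewrite lee_fin mulr_ge0 ?powR_ge0// ltW.
  rewrite -EFinB addrAC subrr add0r lee_fin /ell ler_pM2l//.
  have [->|dn0] := eqVneq (d i) 0; first by rewrite powR0 ?gt_eqF// powR_ge0.
  rewrite ger_powR ?(ltW qg)// lt_neqAle eq_sym dn0 d0/=.
  exact: (le_trans de).
have : (lebesgue_measure G <= \sum_(i <oo) lebesgue_measure (F i))%E.
  apply: measure_sigma_subadditive => //.
  move=> s Gs; have s01 := G01 _ Gs; rewrite /= in s01.
  have [i _ Ui] := cov (\pi_(tree wc) (exist _ s s01))%qT I.
  by exists i => //; apply: AF; split=> //; exists s01.
rewrite leNgt => /negP; apply.
rewrite (@le_lt_trans _ _ (C%:E * eta%:E)%E)//.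
  apply: (@le_trans _ _ (\sum_(i <oo) C%:E * g i)%E).
    by apply: lee_nneseries => // i _; exact: measure_ge0.
  rewrite nneseriesZl; last by move=> i _; exact: hausdorff_gauge_ge0.
  by rewrite lee_pmul2l ?lte_fin// ltW.
rewrite -(fineK muG) -EFinM lte_fin /eta -/m.
have -> : C * (m / (2 * C)) = m / 2 by field; rewrite gt_eqF.
lra.
Qed.

End hausdorff_lower.

(** * Dyadic chaining *)

Section dyadic_chaining.
Context {R : realType}.
Implicit Types (s t al A : R) (n k i : nat).

Definition dyadic_floor n t : R := (Num.truncn (2 ^+ n * t))%:R / 2 ^+ n.

Let pow2_gt0 n : 0 < 2 ^+ n :> R. Proof. by rewrite exprn_gt0. Qed.

Lemma dyadic_floor_itv n t : 0 <= t ->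
  dyadic_floor n t <= t < dyadic_floor n t + (2 ^+ n)^-1.
Proof.
move=> t0; have /truncn_itv/andP[h1 h2] : 0 <= 2 ^+ n * t by rewrite mulr_ge0.
rewrite /dyadic_floor ler_pdivrMr// [t * _]mulrC h1/= -[X in _ + X]div1r -mulrDl natr1.
by rewrite ltr_pdivlMr// mulrC.
Qed.

Lemma dyadic_floor_ge0 n t : 0 <= dyadic_floor n t.
Proof. by rewrite divr_ge0. Qed.

Variables (w : R -> R) (al A : R).
Hypotheses (al0 : 0 < al) (A0 : 0 <= A).
Let th := 2 `^ (- al).
Hypothesis wA : forall n i, (i < 2 ^ n)%N ->
  `|w (i.+1%:R / 2 ^+ n) - w (i%:R / 2 ^+ n)| <= A * th ^+ n.

Let th0 : 0 < th. Proof. exact: powR_gt0. Qed.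
Let th1 : th < 1.
Proof. exact: powR2N_lt1. Qed.

(** Passing to the next level either keeps the dyadic floor or moves it right by one cell of level
    [n.+1]. *)
Let step n t : 0 <= t <= 1 ->
  `|w (dyadic_floor n.+1 t) - w (dyadic_floor n t)| <= A * th ^+ n.+1.
Proof.
move=> /andP[t0 t1].
have h0 : 0 <= A * th ^+ n.+1 by rewrite mulr_ge0// exprn_ge0// ltW.
have /truncn_itv : 0 <= 2 ^+ n * t by rewrite mulr_ge0.
have /truncn_itv : 0 <= 2 ^+ n.+1 * t by rewrite mulr_ge0.
rewrite /dyadic_floor; set D := Num.truncn (2 ^+ n * t).
set D' := Num.truncn (2 ^+ n.+1 * t) => /andP[h1 h2] /andP[h3 h4].
have e1 : D%:R / 2 ^+ n = (2 * D)%:R / 2 ^+ n.+1 :> R.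
  by rewrite exprS natrM; field; rewrite gt_eqF.
have : D' = (2 * D)%N \/ D' = (2 * D).+1.
  have : (2 * D < D'.+1)%N.
    by rewrite -(ltr_nat R) (le_lt_trans _ h2)// natrM exprS -mulrA ler_pM2l.
  have : (D' < 2 * D.+1)%N.
    by rewrite -(ltr_nat R) (le_lt_trans h1)// natrM exprS -mulrA ltr_pM2l.
  lia.
rewrite e1 => -[->|E]; first by rewrite subrr normr0.
rewrite E; apply: wA; rewrite -E -(ler_nat R) natrX (le_trans h1)//.
by rewrite ler_piMr// ltW.
Qed.

(** [B * th ^+ n] is the sum of the geometric series [A * th ^+ k] over [k > n], that is, of all
    later steps. *)
Let B := A * th / (1 - th).

Let steps n k t : 0 <= t <= 1 ->
  `|w (dyadic_floor (n + k) t) - w (dyadic_floor n t)| <=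
  B * th ^+ n * (1 - th ^+ k).
Proof.
move=> t01; elim: k => [|k IH].
  by rewrite addn0 expr0 !subrr normr0 mulr0.
rewrite addnS (le_trans (ler_distD (w (dyadic_floor (n + k) t)) _ _))//.
rewrite (le_trans (lerD (step (n + k) t01) IH))//.
suff -> : A * th ^+ (n + k).+1 = B * th ^+ n * (th ^+ k - th ^+ k.+1) by lra.
rewrite /B !exprS exprD; field.
by rewrite subr_eq0 eq_sym lt_eqF.
Qed.

Hypothesis wc : {within `[0, 1], continuous w}.

(** The bound on finitely many steps is uniform in their number, and the floors converge to [t];
    continuity of [w] at [t] passes to the limit. *)
Let dyadic_floor_near n t : 0 <= t <= 1 ->
  `|w t - w (dyadic_floor n t)| <= B * th ^+ n.
Proof.
move=> /[dup] t01 /andP[t0 t1]; apply/ler_addgt0Pr => eps eps0.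
have t01' : `[0, 1]%classic t by rewrite /= in_itv/= t0.
have /subspace_continuousP/(_ t t01')/cvgrPdist_le/(_ _ eps0) := wc.
rewrite /within/= => /nbhs_ballP[d /= d0 hd].
have [k hk] : exists k, (2 ^+ k)^-1 < d.
  exists (Num.bound d^-1).
  rewrite invf_plt ?posrE//.
  rewrite (lt_trans (archi_boundP _)) ?invr_ge0 ?(ltW d0)//.
  by rewrite -natrX ltr_nat ltn_expl.
have := steps n k t01.
set y := dyadic_floor (n + k) t => hs.
have /andP[y1 y2] := dyadic_floor_itv (n + k) t0.
have kk : (2 ^+ (n + k))^-1 <= (2 ^+ k)^-1 :> R.
  by rewrite lef_pV2 ?posrE// ler_eXn2l ?ltr1n// leq_addl.
have hw : `|w t - w y| <= eps.
  apply: hd; last by rewrite /= in_itv/= dyadic_floor_ge0 (le_trans y1 t1).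
  by rewrite /ball/= -/y in y1 y2 *; rewrite ger0_norm ?subr_ge0//; lra.
rewrite (le_trans (ler_distD (w y) _ _))// addrC lerD//.
rewrite (le_trans hs)// ler_piMr//.
  by rewrite !mulr_ge0// ?exprn_ge0 ?invr_ge0 ?subr_ge0// ltW.
by rewrite lerBlDr lerDl exprn_ge0// ltW.
Qed.

(** At the level [n] with [2^-(n+1) < t - s <= 2^-n] the two floors are equal or adjacent. Two
    chains cost [2 B] and the jump between floors costs [A]; the factor [2^al] replaces [2^-n] by
    [2 (t - s)]. *)
Lemma dyadic_holder : exists2 C : R, 0 <= C &
  forall s t, 0 <= s -> s <= t -> t <= 1 -> `|w t - w s| <= C * (t - s) `^ al.
Proof.
have B0 : 0 <= B by rewrite !mulr_ge0 ?invr_ge0 ?subr_ge0// ltW.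
exists ((2 * B + A) * 2 `^ al) => [|s t s0].
  by rewrite mulr_ge0 ?powR_ge0// addr_ge0// mulr_ge0.
rewrite le_eqVlt => /orP[/eqP <-|st] t1.
  by rewrite !subrr normr0 powR0 ?mulr0// gt_eqF.
have t0 : 0 <= t by exact: ltW (le_lt_trans s0 st).
have s01 : 0 <= s <= 1 by rewrite s0 (le_trans (ltW st)).
have t01 : 0 <= t <= 1 by rewrite t0.
have exn : exists n, (2 ^+ n.+1)^-1 < t - s.
  exists (Num.bound (t - s)^-1).
  rewrite invf_plt ?posrE ?subr_gt0//.
  rewrite (lt_trans (archi_boundP _)) ?invr_ge0 ?subr_ge0 ?(ltW st)//.
  by rewrite -natrX ltr_nat (ltn_trans (ltn_expl _ (isT : 1 < 2)%N))// ltn_exp2l.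
case: (ex_minnP exn) => n hn nmin.
have nle : t - s <= (2 ^+ n)^-1.
  (* Minimality says nothing at [n = 0], where the bound is [t - s <= 1]. *)
  case: n hn nmin => [|n] hn nmin; first by rewrite expr0 invr1; lra.
  rewrite leNgt; apply/negP => /nmin; lia.
have hs := dyadic_floor_near n s01.
have ht := dyadic_floor_near n t01.
have hst : `|w (dyadic_floor n t) - w (dyadic_floor n s)| <= A * th ^+ n.
  have h0 : 0 <= A * th ^+ n by rewrite mulr_ge0// exprn_ge0// ltW.
  have /truncn_itv/andP[h1 h2] : 0 <= 2 ^+ n * s by rewrite mulr_ge0.
  have /truncn_itv/andP[h3 h4] : 0 <= 2 ^+ n * t by rewrite mulr_ge0.
  have d1 : 2 ^+ n * t - 2 ^+ n * s <= 1 by rewrite -mulrBr -ler_pdivlMl// mulr1.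
  have d2 : 2 ^+ n * s < 2 ^+ n * t by rewrite ltr_pM2l.
  rewrite /dyadic_floor; move: h1 h2 h3 h4.
  set D := Num.truncn (2 ^+ n * s); set D' := Num.truncn (2 ^+ n * t) => h1 h2 h3 h4.
  have hDD (p q : nat) : (p < q.+2)%N -> (q < p.+1)%N -> p = q \/ p = q.+1 by clear; lia.
  have : D' = D \/ D' = D.+1.
    apply: hDD; first by rewrite -(ltr_nat R) -[D.+2%:R]natr1; lra.
    by rewrite -(ltr_nat R); lra.
  move=> [->|E]; first by rewrite subrr normr0.
  rewrite E; apply: wA; rewrite -E -(ler_nat R) natrX (le_trans h3)//.
  by rewrite ler_piMr// ltW.
have hth : th ^+ n <= 2 `^ al * (t - s) `^ al.
  rewrite -powRM ?subr_ge0 ?(ltW st)//.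
  have -> : th ^+ n = ((2 ^+ n)^-1) `^ al.
    rewrite /th -powR_mulrn ?powR_ge0// -powRrM -powR_mulrn// -powRN -powRrM.
    by rewrite !mulNr mulrC.
  apply: ge0_ler_powR; rewrite ?nnegrE ?invr_ge0 ?mulr_ge0 ?subr_ge0
    ?(ltW al0) ?(ltW st) ?(ltW (pow2_gt0 _))//.
  rewrite exprS invfM in hn; lra.
have -> : w t - w s = (w t - w (dyadic_floor n t)) +
   (w (dyadic_floor n t) - w (dyadic_floor n s)) - (w s - w (dyadic_floor n s)) by ring.
rewrite (le_trans (ler_normB _ _))// (le_trans (lerD (ler_normD _ _) (lexx _)))//.
rewrite (le_trans (lerD (lerD ht hst) hs))//.
have -> : B * th ^+ n + A * th ^+ n + B * th ^+ n = (2 * B + A) * th ^+ n by ring.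
by rewrite -mulrA ler_wpM2l// addr_ge0// mulr_ge0.
Qed.

End dyadic_chaining.

Section eventual_dyadic.
Context {R : realType}.
Variables (w : R -> R) (al : R).
Hypotheses (al0 : 0 < al) (wc : {within `[0, 1], continuous w}).

(** The finitely many levels below [n0] are absorbed in the constant: there an increment is at most
    the oscillation of [w], and [th ^- n0 * th ^+ n >= 1]. *)
Lemma eventual_dyadic_holder (n0 : nat) :
  (forall n i, (n0 <= n)%N -> (i < 2 ^ n)%N ->
    `|w (i.+1%:R / 2 ^+ n) - w (i%:R / 2 ^+ n)| <= (2 `^ (- al)) ^+ n) ->
  exists2 C : R, 0 <= C &
  forall s t, 0 <= s -> s <= t -> t <= 1 -> `|w t - w s| <= C * (t - s) `^ al.
Proof.
move=> h.
have [a a01 wa] := EVT_min ler01 wc.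
have [b b01 wb] := EVT_max ler01 wc.
have th0 : 0 < 2 `^ (- al) :> R by exact: powR_gt0.
have th1 := powR2N_lt1 al0.
set th := 2 `^ (- al) in th0 th1 h *.
have ab : w a <= w b by exact: wb.
pose A := 1 + (w b - w a) * th ^- n0.
have A1 : 1 <= A by rewrite lerDl mulr_ge0 ?subr_ge0// invr_ge0 exprn_ge0// ltW.
apply: (@dyadic_holder _ _ al A) => //; first exact: le_trans A1.
move=> n i i2; rewrite -/th.
have thn : 0 <= th ^+ n by rewrite exprn_ge0// ltW.
have [nn|nn] := leqP n0 n.
  by rewrite (le_trans (h _ _ nn i2))// ler_peMl.
have d01 k : (k <= 2 ^ n)%N -> k%:R / 2 ^+ n \in `[0 : R, 1].
  move=> k2; rewrite in_itv/= divr_ge0 ?exprn_ge0//= ler_pdivrMr ?exprn_gt0//.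
  by rewrite mul1r -natrX ler_nat.
apply: (@le_trans _ _ (w b - w a)).
  have := wa _ (d01 i.+1 i2); have := wb _ (d01 i.+1 i2).
  have := wa _ (d01 i (ltnW i2)); have := wb _ (d01 i (ltnW i2)).
  by rewrite ler_norml; move=> *; apply/andP; split; lra.
rewrite (@le_trans _ _ ((w b - w a) * th ^- n0 * th ^+ n))//.
  rewrite -mulrA ler_peMr ?subr_ge0// mulrC.
  rewrite ler_pdivlMr ?exprn_gt0// mul1r.
  by rewrite ler_wiXn2l ?(ltW th0) ?(ltW th1)// ltnW.
by rewrite ler_wpM2r// /A lerDr.
Qed.

End eventual_dyadic.

(** * Gaussian moments *)

Section normal_integrals.
Context {R : realType}.
Variables (m s : R).
Notation mu := (@lebesgue_measure R).

Import HBNNSimple.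

Let integral_normal_prob_indic (E : set R) : measurable E ->
  (\int[normal_prob m s]_x (\1_E x)%:E =
   \int[mu]_x ((\1_E x)%:E * (normal_pdf m s x)%:E))%E.
Proof.
move=> mE; rewrite integral_indic//= setIT /normal_prob integral_mkcond.
apply: eq_integral => x _; rewrite patchE indicE.
by case: ifPn => xE; rewrite ?mul1e ?mul0e.
Qed.

Let mpdf : measurable_fun [set: R] (EFin \o normal_pdf m s).
Proof. apply/measurable_EFinP. exact: measurable_normal_pdf. Qed.

Let integral_normal_prob_nnsfun (f : {nnsfun _ >-> R}) :
  (\int[normal_prob m s]_x (f x)%:E =
   \int[mu]_x ((f x)%:E * (normal_pdf m s x)%:E))%E.
Proof.
under [LHS]eq_integral do rewrite fimfunE -fsumEFin//.
rewrite [LHS]ge0_integral_fsum//; last 2 first.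
  - by move=> r; exact/measurable_EFinP/measurableT_comp.
  - by move=> n x _; rewrite EFinM nnfun_muleindic_ge0.
under [RHS]eq_integral.
  move=> x xD; rewrite fimfunE -fsumEFin// muleC ge0_mule_fsumr; last first.
    by move=> r; rewrite EFinM nnfun_muleindic_ge0.
  over.
rewrite [RHS]ge0_integral_fsum//; last 2 first.
  - move=> r; apply: emeasurable_funM => //.
    by apply/measurable_EFinP; apply/measurableT_comp.
  - move=> n x _; rewrite EFinM mule_ge0//; last by rewrite nnfun_muleindic_ge0.
    by rewrite lee_fin normal_pdf_ge0.
apply: eq_fsbigr => r /set_mem[x _ fxr].
have r0 : (0 <= r%:E)%E by rewrite -fxr lee_fin.
under eq_integral do rewrite EFinM.
rewrite ge0_integralZl//; last first.
  apply/measurable_EFinP; exact: measurable_indic.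
rewrite integral_normal_prob_indic; last exact: (measurable_funPTI f (measurable_set1 r)).
under [RHS]eq_integral do rewrite EFinM muleCA (muleC (normal_pdf _ _ _)%:E).
rewrite [RHS]ge0_integralZl//.
  apply: emeasurable_funM => //; apply/measurable_EFinP; exact: measurable_indic.
by move=> y _; rewrite mule_ge0// lee_fin ?normal_pdf_ge0.
Qed.

Lemma integral_normal_prob (f : _ -> \bar R) :
  measurable_fun setT f -> (forall x, 0 <= f x)%E ->
  (\int[normal_prob m s]_x f x =
   \int[mu]_x (f x * (normal_pdf m s x)%:E))%E.
Proof.
move=> mf f0.
pose f_ := nnsfun_approx measurableT mf.
transitivity (lim (\int[normal_prob m s]_x (f_ n x)%:E @[n --> \oo])%E).
  rewrite -monotone_convergence//=.
  - apply: eq_integral => ? /[!inE] xD; apply/esym/cvg_lim => //=.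
    exact: cvg_nnsfun_approx.
  - by move=> n; exact/measurable_EFinP/measurable_funTS.
  - by move=> n ? _; rewrite lee_fin.
  - by move=> ? _ ? ? mn; rewrite lee_fin; exact/lefP/nd_nnsfun_approx.
rewrite [RHS](_ : _ = lim
    (\int[mu]_x ((f_ n x)%:E * (normal_pdf m s x)%:E) @[n --> \oo])%E).
  by apply: congr_lim; apply/funext => n /=; exact: integral_normal_prob_nnsfun.
rewrite -monotone_convergence//=.
- apply: eq_integral => x _; apply/esym/cvg_lim => //.
  apply: cvgeZr => //; exact: cvg_nnsfun_approx.
- move=> n; apply: emeasurable_funM => //.
  exact/measurable_EFinP/measurable_funTS.
- by move=> n x _; rewrite -EFinM lee_fin mulr_ge0// normal_pdf_ge0.
- move=> x _ a b ab; rewrite lee_wpmul2r ?lee_fin ?normal_pdf_ge0//.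
  exact/lefP/nd_nnsfun_approx.
Qed.

Hypothesis s0 : s != 0.

Lemma integral_expR_normal_prob (t : R) :
  (\int[normal_prob m s]_x (expR (t * x))%:E =
   (expR (t * m + t ^+ 2 * s ^+ 2 / 2))%:E)%E.
Proof.
rewrite integral_normal_prob; first last.
- by move=> x; rewrite lee_fin expR_ge0.
- by apply/measurable_EFinP/measurableT_comp => //; exact: mulrl_measurable.
(* Completing the square: the tilted density is the normal density with mean shifted by [t s^2]. *)
transitivity (\int[mu]_x ((expR (t * m + t ^+ 2 * s ^+ 2 / 2))%:E *
    (normal_pdf (m + t * s ^+ 2) s x)%:E))%E.
  apply: eq_integral => x _; rewrite -!EFinM; congr EFin.
  rewrite !normal_pdfE// mulrCA [RHS]mulrCA; congr *%R.
  rewrite /normal_fun -!expRD; congr expR.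
  by field.
rewrite ge0_integralZl//; last 2 first.
- by apply/measurable_EFinP; exact: measurable_normal_pdf.
- by move=> x _; rewrite lee_fin normal_pdf_ge0.
by rewrite integral_normal_pdf mule1.
Qed.

End normal_integrals.

Section normal_variance.
Context {R : realType}.
Variable s : R.
Hypothesis s0 : s != 0.
Notation mu := (@lebesgue_measure R).

Let pdf (x : R) : R := normal_peak s * expR (- x ^+ 2 / (s ^+ 2 *+ 2)).

Let pdfE : normal_pdf 0 s = pdf.
Proof. by apply/funext => x; rewrite normal_pdfE// /normal_fun subr0. Qed.

Let pdf_ge0 x : 0 <= pdf x.
Proof. by rewrite -pdfE normal_pdf_ge0. Qed.

Let cpdf : continuous pdf.
Proof. by rewrite -pdfE; exact: continuous_normal_pdf. Qed.

(** A primitive of [(s^2 - x^2) pdf], vanishing at 0 and at infinity. Hence [x^2] and [s^2] have the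
    same integral against [pdf] on the half-line. *)
Let F (x : R) : R := s ^+ 2 * (x * pdf x).

Let dF (x : R) : is_derive x 1 F ((s ^+ 2 - x ^+ 2) * pdf x).
Proof. by rewrite /F /pdf; apply: is_derive_eq; rewrite /GRing.scale/=; field. Qed.

Let s2 : 0 < s ^+ 2. Proof. by rewrite exprn_even_gt0. Qed.

Let cvg_F : F x @[x --> +oo] --> 0.
Proof.
have peak0 := normal_peak_ge0 s.
(* From [exp y >= y] with [y = x^2 / (2 s^2)]. *)
apply: (@squeeze_cvgr _ _ _ _ (cst 0) (fun x => (2 * s ^+ 4 * normal_peak s) * x^-1)).
- near=> x.
  have x0 : 0 < x by near: x; exact: nbhs_pinfty_gt.
  have F0 : 0 <= F x.
    by apply: mulr_ge0; [exact: ltW|apply: mulr_ge0 => //; exact: ltW].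
  rewrite /= F0 /=.
  rewrite /F /pdf mulNr expRN.
  have y0 : 0 < x ^+ 2 / (s ^+ 2 *+ 2) by rewrite divr_gt0 ?exprn_gt0// pmulrn_lgt0.
  have : (expR (x ^+ 2 / (s ^+ 2 *+ 2)))^-1 <= (x ^+ 2 / (s ^+ 2 *+ 2))^-1.
    rewrite lef_pV2 ?posrE ?expR_gt0//.
    by rewrite (le_trans _ (expR_ge1Dx _))// lerDr.
  set e := (expR _)^-1 => he.
  have -> : 2 * s ^+ 4 * normal_peak s / x =
     s ^+ 2 * (x * (normal_peak s * (x ^+ 2 / (s ^+ 2 *+ 2))^-1)).
    by field; rewrite s0 gt_eqF.
  by rewrite ler_pM2l// ler_pM2l// ler_wpM2l.
- exact: cvg_cst.
- rewrite -[X in _ --> X](mulr0 (2 * s ^+ 4 * normal_peak s)).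
  apply: cvgM; first exact: cvg_cst.
  apply/cvgrVy; last first.
    by rewrite [X in X @ _](_ : _ = id); [exact: cvg_id|apply/funext => x /=; rewrite invrK].
  by near=> x; rewrite invr_gt0; near: x; exact: nbhs_pinfty_gt.
Unshelve. all: by end_near. Qed.

Let a : R := `|s|.
Let a0 : 0 < a. Proof. by rewrite normr_gt0. Qed.
Let a2 : a ^+ 2 = s ^+ 2. Proof. by rewrite real_normK// num_real. Qed.

Let I1 : (\int[mu]_(x in `[0%R, a]) ((s ^+ 2 - x ^+ 2) * pdf x)%:E = (F a)%:E)%E.
Proof.
rewrite (continuous_FTC2 (F := F))//.
- by rewrite {2}/F mul0r mulr0 sube0.
- apply: continuous_subspaceT => x; apply: cvgM; last exact: cpdf.
  by apply: cvgB; [exact: cvg_cst|exact: exprn_continuous].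
- split.
  + by move=> x _; case: (dF x).
  + apply: cvg_at_right_filter; apply: differentiable_continuous.
    by apply/derivable1_diffP; case: (dF 0).
  + apply: cvg_at_left_filter; apply: differentiable_continuous.
    by apply/derivable1_diffP; case: (dF a).
- by move=> x _; rewrite derive1E; exact: derive_val.
Qed.

Let I2 : (\int[mu]_(x in `[a, +oo[) ((x ^+ 2 - s ^+ 2) * pdf x)%:E = (F a)%:E)%E.
Proof.
have dNF (x : R) : is_derive x 1 (fun y : R => - F y) ((x ^+ 2 - s ^+ 2) * pdf x).
  by apply: is_derive_eq; rewrite /GRing.scale/= /pdf; field.
rewrite (ge0_continuous_FTC2y (F := fun x => - F x) (l := 0))//.
- by rewrite sub0e -EFinN opprK.
- move=> x ax; rewrite mulr_ge0// subr_ge0 -a2.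
  by rewrite ler_pXn2r// nnegrE ?ltW// (lt_le_trans a0).
- apply: continuous_subspaceT => x; apply: cvgM; last exact: cpdf.
  by apply: cvgB; [exact: exprn_continuous|exact: cvg_cst].
- by rewrite -oppr0; exact: cvgN.
- apply: cvg_at_right_filter.
  have : {for a, continuous (fun y : R => - F y)}; last exact.
  apply: differentiable_continuous.
  by apply/derivable1_diffP; case: (dNF a).
- by move=> x _; rewrite derive1E; exact: derive_val.
Qed.

Let mf (f : R -> R) (D : set R) : continuous f -> measurable_fun D (EFin \o f).
Proof.
move=> cf; apply/measurable_EFinP; apply: measurable_funTS.
exact: continuous_measurable_fun.
Qed.

Let cx2 (c : R) : continuous (fun x : R => (c - x ^+ 2) * pdf x).
Proof.
move=> x; apply: cvgM; last exact: cpdf.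
by apply: cvgB; [exact: cvg_cst|exact: exprn_continuous].
Qed.

Let cx2' (c : R) : continuous (fun x : R => (x ^+ 2 - c) * pdf x).
Proof.
move=> x; apply: cvgM; last exact: cpdf.
by apply: cvgB; [exact: exprn_continuous|exact: cvg_cst].
Qed.

Let cx20 : continuous (fun x : R => x ^+ 2 * pdf x).
Proof. by move=> x; apply: cvgM; [exact: exprn_continuous|exact: cpdf]. Qed.

Let cs2 : continuous (fun x : R => s ^+ 2 * pdf x).
Proof. by move=> x; apply: cvgM; [exact: cvg_cst|exact: cpdf]. Qed.

(** The difference changes sign at [a = |s|]. Below [a] the [s^2] integral exceeds the other by
    [F a], above [a] it falls short by [F a]; the split keeps every integrand nonnegative. *)
Let half : (\int[mu]_(x in `[0%R, +oo[) (x ^+ 2 * pdf x)%:E =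
            \int[mu]_(x in `[0%R, +oo[) (s ^+ 2 * pdf x)%:E)%E.
Proof.
have split (f : R -> R) : continuous f -> (forall x, 0 <= f x) ->
    (\int[mu]_(x in `[0%R, +oo[) (f x)%:E =
     \int[mu]_(x in `[0%R, a]) (f x)%:E + \int[mu]_(x in `[a, +oo[) (f x)%:E)%E.
  move=> cf f0; have -> : `[0, +oo[%classic = `[0, a[%classic `|` `[a, +oo[%classic.
    by rewrite -itv_bndbnd_setU// bnd_simp ltW.
  rewrite ge0_integral_setU//=; first last.
  - apply/disj_setPS => x [/=]; rewrite !in_itv/= andbT => /andP[_ xa].
    by rewrite leNgt xa.
  - by move=> x _; rewrite lee_fin.
  - exact: mf.
  by congr adde; rewrite integral_itv_bndo_bndc//; exact: mf.
rewrite !split//; first last.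
- by move=> x; rewrite mulr_ge0// sqr_ge0.
- by move=> x; rewrite mulr_ge0// sqr_ge0.
have -> : (\int[mu]_(x in `[0%R, a]) (s ^+ 2 * pdf x)%:E =
    \int[mu]_(x in `[0%R, a]) (x ^+ 2 * pdf x)%:E + (F a)%:E)%E.
  rewrite -I1 -ge0_integralD//.
  - by apply: eq_integral => x _; rewrite -EFinD; congr EFin; ring.
  - by move=> x _; rewrite lee_fin mulr_ge0// sqr_ge0.
  - exact: (mf (f := fun x => x ^+ 2 * pdf x)).
  - move=> x; rewrite /= in_itv/= => /andP[x0 xa].
    rewrite lee_fin mulr_ge0// subr_ge0 -a2.
    by rewrite ler_pXn2r// nnegrE ltW.
  - exact: (mf (f := fun x => (s ^+ 2 - x ^+ 2) * pdf x)).
have -> : (\int[mu]_(x in `[a, +oo[) (x ^+ 2 * pdf x)%:E =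
    \int[mu]_(x in `[a, +oo[) (s ^+ 2 * pdf x)%:E + (F a)%:E)%E.
  rewrite -I2 -ge0_integralD//.
  - by apply: eq_integral => x _; rewrite -EFinD; congr EFin; ring.
  - by move=> x _; rewrite lee_fin mulr_ge0// sqr_ge0.
  - exact: (mf (f := fun x => s ^+ 2 * pdf x)).
  - move=> x; rewrite /= in_itv/= andbT => ax.
    rewrite lee_fin mulr_ge0// subr_ge0 -a2.
    by rewrite ler_pXn2r// nnegrE ?ltW// (lt_le_trans a0).
  - exact: (mf (f := fun x => (x ^+ 2 - s ^+ 2) * pdf x)).
by rewrite addeA addeAC.
Qed.

Lemma integral_sqr_normal_prob :
  (\int[normal_prob 0 s]_x (x ^+ 2)%:E = (s ^+ 2)%:E)%E.
Proof.
rewrite integral_normal_prob; first last.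
- by move=> x; rewrite lee_fin sqr_ge0.
- by apply/measurable_EFinP; exact: exprn_measurable.
rewrite pdfE; under eq_integral do rewrite -EFinM.
have c0 : [set x : R | 0 <= x] = `[0, +oo[%classic.
  by apply/seteqP; split => x /=; rewrite in_itv/= andbT.
rewrite ge0_symfun_integralT//; first last.
- by move=> x /=; rewrite /pdf !sqrrN.
- by move=> x; rewrite mulr_ge0// sqr_ge0.
rewrite c0 half -c0 -ge0_symfun_integralT//; first last.
- by move=> x /=; rewrite /pdf !sqrrN.
- by move=> x; rewrite mulr_ge0// sqr_ge0.
under eq_integral do rewrite EFinM -pdfE.
rewrite ge0_integralZl//; last 3 first.
- by apply/measurable_EFinP; exact: measurable_normal_pdf.
- by move=> x _; rewrite lee_fin normal_pdf_ge0.
- by rewrite lee_fin ltW.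
by rewrite integral_normal_pdf mule1.
Qed.

End normal_variance.

Section gaussian_law.
Context {R : realType} {d : measure_display} {T : measurableType d}.
Variable P : probability T R.

Lemma ge0_integral_gaussian (X : T -> R) (m s : R) (f : R -> \bar R) :
  measurable_fun setT X ->
  (forall A : set R, measurable A ->
    pushforward P X A = if s == 0 then \d_m A else normal_prob m s A) ->
  measurable_fun setT f -> (forall x, 0 <= f x)%E ->
  (\int[P]_x f (X x))%E = if s == 0 then f m else (\int[normal_prob m s]_y f y)%E.
Proof.
move=> mX hX mf f0.
have mX' : measurable_fun [set: T] (X : T -> measurableTypeR R) by [].
have mf' : measurable_fun [set: measurableTypeR R] (f : measurableTypeR R -> \bar R) by [].
have := @ge0_integral_pushforward _ _ _ (measurableTypeR R) R X mX' P setT f measurableT mf'.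
rewrite preimage_setT => <-; last by move=> y _; exact: f0.
case: ifPn => s0.
  transitivity (\int[@dirac _ (measurableTypeR R) m R]_y f y)%E.
    by apply: eq_measure_integral => A mA _; have := hX A mA; rewrite s0.
  by rewrite integral_dirac// diracT mul1e.
apply: eq_measure_integral => A mA _.
by have := hX A mA; rewrite (negbTE s0).
Qed.

(** The parameters [m], [s] of the law are not given as mean and deviation of [X]. They are
    identified from the exponential moments, which force [m = 0], and from the second moment, which
    gives [v = s^2]. *)
Lemma gaussian_expR (X : T -> R) :
  measurable_fun setT X -> gaussian_rv P X ->
  P.-integrable setT (EFin \o X) -> (\int[P]_x (X x)%:E = 0)%E ->
  forall v : R, (\int[P]_x (X x ^+ 2)%:E = v%:E)%E ->
  (\int[P]_x (expR (X x))%:E = (expR (v / 2))%:E)%E.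
Proof.
move=> mX [m [s hX]] iX EX v VX.
have mexp t : measurable_fun [set: R] (fun y : R => (expR (t * y))%:E).
  by apply/measurable_EFinP/measurableT_comp => //; exact: mulrl_measurable.
have M t : (\int[P]_x (expR (t * X x))%:E =
            (expR (t * m + t ^+ 2 * s ^+ 2 / 2))%:E)%E.
  rewrite (ge0_integral_gaussian mX hX (f := fun y => (expR (t * y))%:E))//.
  - case: ifPn => [/eqP ->|s0]; last exact: integral_expR_normal_prob.
    by rewrite expr0n/= mulr0 mul0r addr0.
(* [1 <= E[exp (t X)]] for all [t], since [1 + t x <= exp (t x)] and [E[X] = 0]. *)
have m0 : m = 0.
  have key t : 0 <= t * m + t ^+ 2 * s ^+ 2 / 2.
    rewrite -ler_expR expR0 -lee_fin -M.
    have iC : P.-integrable setT (fun x => (1 + t * X x)%:E).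
      apply: (eq_integrable _ (cst 1 \+ (fun x => t%:E * (X x)%:E))%E) => //.
      apply: integrableD => //; last exact: integrableZl.
      by apply: finite_measure_integrable_cst.
    have -> : (1 = \int[P]_x (1 + t * X x)%:E)%E.
      under eq_integral do rewrite EFinD EFinM.
      rewrite integralD//; last 2 first.
      - exact: finite_measure_integrable_cst.
      - exact: integrableZl.
      rewrite integralZl// EX mule0 adde0 integral_cst//.
      by rewrite mul1e; apply/esym; exact: probability_setT.
    apply: le_integral => //.
      apply/integrableP; split.
        by apply: measurableT_comp (mexp t) mX.
      under eq_integral do rewrite gee0_abs ?lee_fin ?expR_ge0//.
      by rewrite M ltry.
    by move=> x _; rewrite lee_fin expR_ge1Dx.
  apply/eqP; apply: contraT => m0.
  have m2 : 0 < m ^+ 2 by rewrite exprn_even_gt0.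
  have s2 : 0 <= s ^+ 2 by rewrite sqr_ge0.
  have s21 : 0 < s ^+ 2 + 1 by lra.
  (* Near the minimizer [-m / s^2] of the quadratic, with a denominator that stays positive when
     [s = 0]; the value there is negative unless [m = 0]. *)
  have := key (- m / (s ^+ 2 + 1)).
  have -> : - m / (s ^+ 2 + 1) * m + (- m / (s ^+ 2 + 1)) ^+ 2 * s ^+ 2 / 2 =
    - (m ^+ 2 * (s ^+ 2 + 2) / (2 * (s ^+ 2 + 1) ^+ 2)).
    by field; rewrite gt_eqF.
  rewrite oppr_ge0 leNgt divr_gt0//; first by rewrite mulr_gt0//; lra.
  by rewrite mulr_gt0// exprn_gt0.
have vs : v = s ^+ 2.
  apply/EFin_inj; rewrite -VX m0 in hX *.
  rewrite (ge0_integral_gaussian mX hX (f := fun y => (y ^+ 2)%:E))//.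
  - case: ifPn => [/eqP ->|s0]; first by rewrite expr0n.
    exact: integral_sqr_normal_prob.
  - by apply/measurable_EFinP; exact: exprn_measurable.
  - by move=> x; rewrite lee_fin sqr_ge0.
have := M 1; rewrite m0 mulr0 add0r expr1n mul1r -vs.
by under eq_integral do rewrite mul1r.
Qed.

End gaussian_law.

(** * Exponential moments of fractional Brownian motion *)

Definition fbm_cov {R : realType} (H sigma s t : R) : R :=
  sigma ^+ 2 / 2 * (`|s| `^ (2 * H) + `|t| `^ (2 * H) - `|t - s| `^ (2 * H)).

Section fbm.
Context {R : realType} {d : measure_display} {T : measurableType d}.
Variable P : probability T R.
Variables (H sigma : R) (W : R -> {RV P >-> R}).
Hypothesis W_fbm : fractional_brownian_motion H sigma W.

Let EW t : t \in `[0, 1] -> (\int[P]_x (W t x)%:E = 0)%E.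
Proof. by case: W_fbm => _ /(_ t) + _ => /[apply]; rewrite unlock. Qed.

Let EWW s t : s \in `[0, 1] -> t \in `[0, 1] ->
  (\int[P]_x (W s x * W t x)%:E = (fbm_cov H sigma s t)%:E)%E.
Proof.
move=> s01 t01; case: W_fbm => _ EE /(_ _ _ s01 t01) <-.
rewrite unlock (EE _ s01) (EE _ t01) unlock/=.
by apply: eq_integral => x _; rewrite !fctE /= !subr0.
Qed.

(** The square is nonnegative, so the finite variance is itself the integrability. It then dominates
    [W t] through [1 + W^2], and products through a sum of two squares. *)
Let iW2 t : t \in `[0, 1] -> P.-integrable setT (fun x => (W t x * W t x)%:E).
Proof.
move=> t01; apply/integrableP; split.
  by apply/measurable_EFinP; exact: measurable_funM.
rewrite (eq_integral (fun x => (W t x * W t x)%:E)); first by rewrite EWW// ltry.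
by move=> x _; rewrite gee0_abs// lee_fin -expr2 sqr_ge0.
Qed.

Let iW t : t \in `[0, 1] -> P.-integrable setT (EFin \o W t).
Proof.
move=> t01.
apply: (@le_integrable _ _ _ _ _ measurableT _ (fun x => (1 + W t x * W t x)%:E)).
- exact/measurable_EFinP.
- move=> x _; rewrite /= lee_fin [leRHS]ger0_norm ?addr_ge0 -?expr2 ?sqr_ge0//.
  have : 0 <= (`|W t x| - 1) ^+ 2 by exact: sqr_ge0.
  rewrite sqrrB expr1n mulr1 real_normK ?num_real// => h.
  have : 0 <= `|W t x| by [].
  lra.
- apply: (eq_integrable _ (cst 1 \+ (fun x => (W t x * W t x)%:E))%E) => //.
  by apply: integrableD; [|exact: finite_measure_integrable_cst|exact: iW2].
Qed.

Let iWW s t : s \in `[0, 1] -> t \in `[0, 1] ->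
  P.-integrable setT (fun x => (W s x * W t x)%:E).
Proof.
move=> s01 t01.
apply: (@le_integrable _ _ _ _ _ measurableT _
  (fun x => (W s x * W s x + W t x * W t x)%:E)).
- by apply/measurable_EFinP; exact: measurable_funM.
- move=> x _; rewrite /= lee_fin [leRHS]ger0_norm ?addr_ge0 -?expr2 ?sqr_ge0//.
  rewrite ler_norml.
  have : 0 <= (W s x - W t x) ^+ 2 by exact: sqr_ge0.
  have : 0 <= (W s x + W t x) ^+ 2 by exact: sqr_ge0.
  have : 0 <= (W s x) ^+ 2 by exact: sqr_ge0.
  have : 0 <= (W t x) ^+ 2 by exact: sqr_ge0.
  by rewrite !expr2 => *; apply/andP; split; lra.
- apply: (eq_integrable _ ((fun x => (W s x * W s x)%:E) \+ (fun x => (W t x * W t x)%:E))%E) => //.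
  by apply: integrableD; [|exact: iW2|exact: iW2].
Qed.

Lemma fbm_expR_comb (n : nat) (t a : 'I_n -> R) :
  (forall i, t i \in `[0, 1]) ->
  (\int[P]_x (expR (\sum_(i < n) a i * W (t i) x))%:E =
   (expR
    ((\sum_(i < n) \sum_(j < n) a i * a j * fbm_cov H sigma (t i) (t j)) / 2))%:E)%E.
Proof.
move=> t01; pose X x := \sum_(i < n) a i * W (t i) x.
have iaW i : P.-integrable setT (fun x => (a i * W (t i) x)%:E).
  apply: (eq_integrable _ (fun x => ((a i)%:E * (EFin \o W (t i)) x)%E)) => //.
  exact/integrableZl/iW.
have iaWW i j : P.-integrable setT
    (fun x => (a i * a j * (W (t i) x * W (t j) x))%:E).
  apply: (eq_integrable _ (fun x => ((a i * a j)%:E * (W (t i) x * W (t j) x)%:E)%E)) => //.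
  exact/integrableZl/iWW.
have XE x : ((X x)%:E = \sum_(i < n) (a i * W (t i) x)%:E)%E by rewrite -sumEFin.
apply: gaussian_expR => //.
- apply: measurable_sum => i; exact: measurable_funM.
- by case: W_fbm => + _ _; apply.
- apply: (eq_integrable _ (fun x => \sum_(i < n) (a i * W (t i) x)%:E)%E) => //.
    by move=> x _; rewrite /= -XE.
  exact: (@integrable_sum _ _ _ _ _ measurableT _ _ _ (fun i x => (a i * W (t i) x)%:E)).
- under eq_integral do rewrite XE.
  rewrite integral_sum//; apply: big1 => i _.
  under eq_integral do rewrite EFinM.
  by rewrite integralZl ?EW ?mule0//; exact: iW.
have X2E x : ((X x ^+ 2)%:E = \sum_(i < n) \sum_(j < n) (a i * a j * (W (t i) x * W (t j) x))%:E)%E.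
  under [RHS]eq_bigr do rewrite sumEFin.
  rewrite sumEFin; congr EFin; rewrite expr2 /X mulr_suml; apply: eq_bigr => i _.
  rewrite mulr_sumr; apply: eq_bigr => j _; ring.
under eq_integral do rewrite X2E.
rewrite integral_sum//; last first.
  move=> i; exact: (@integrable_sum _ _ _ _ _ measurableT _ _ _
    (fun j x => (a i * a j * (W (t i) x * W (t j) x))%:E)).
rewrite -sumEFin; apply: eq_bigr => i _.
rewrite integral_sum// -sumEFin; apply: eq_bigr => j _.
under eq_integral do rewrite EFinM.
by rewrite integralZl ?EWW//; exact: iWW.
Qed.

(** A combination of [W] at three times with coefficients of sum 0. All powers of [s], [s + u],
    [s + v] cancel, which is the stationarity of the increments. *)
Lemma fbm_expR_increments (s u v al be : R) : 0 < H ->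
  s \in `[0, 1] -> s + u \in `[0, 1] -> s + v \in `[0, 1] ->
  (\int[P]_x (expR (al * (W (s + u) x - W s x) + be * (W (s + v) x - W s x)))%:E =
   (expR (sigma ^+ 2 / 2 * (al ^+ 2 * `|u| `^ (2 * H) + be ^+ 2 * `|v| `^ (2 * H) +
     al * be * (`|u| `^ (2 * H) + `|v| `^ (2 * H) - `|u - v| `^ (2 * H)))))%:E)%E.
Proof.
move=> H0 s0 su sv.
pose t (i : 'I_3) := tnth [tuple s; s + u; s + v] i.
pose a (i : 'I_3) := tnth [tuple - (al + be); al; be] i.
have t01 i : t i \in `[0, 1].
  by rewrite /t; case: i => -[|[|[|//]]] ? /=; rewrite /tnth/=.
have := fbm_expR_comb a t01.
under eq_integral.
  move=> x _; rewrite !big_ord_recl big_ord0 /t /a !(tnth_nth 0)/=.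
  rewrite (_ : _ + _ = al * (W (s + u) x - W s x) + be * (W (s + v) x - W s x)); last ring.
  over.
move=> ->; congr (expR _)%:E.
rewrite !big_ord_recl !big_ord0 /t /a !(tnth_nth 0)/= /fbm_cov.
have -> : s + u - s = u by ring.
have -> : s + v - s = v by ring.
have -> : s - (s + u) = - u by ring.
have -> : s - (s + v) = - v by ring.
have -> : s + u - (s + v) = u - v by ring.
have -> : s + v - (s + u) = - (u - v) by ring.
rewrite !subrr !normrN normr0 powR0 ?mulf_neq0 ?gt_eqF//.
set S := `|s| `^ _; set A := `|s + u| `^ _; set B := `|s + v| `^ _.
set U := `|u| `^ _; set V := `|v| `^ _; set D := `|u - v| `^ _.
by field.
Qed.

End fbm.

(** * Hoelder continuity of fractional Brownian motion *)

Section series_bounds.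
Context {R : realType}.

Lemma geometric_sum_le (z : R) n : 0 <= z -> z < 1 ->
  \sum_(i < n) z ^+ i <= (1 - z)^-1.
Proof.
move=> z0 z1; have z10 : 0 < 1 - z by rewrite subr_gt0.
rewrite -[leRHS]mul1r ler_pdivlMr// mulrC.
have -> : (1 - z) * (\sum_(i < n) z ^+ i) = 1 - z ^+ n.
  by rewrite -opprB mulNr -subrX1 opprB.
by rewrite gerBl exprn_ge0.
Qed.

Lemma nneseries_lty (f : nat -> \bar R) (M : R) :
  (forall i, 0 <= f i)%E -> (forall n, \sum_(0 <= i < n) f i <= M%:E)%E ->
  (\sum_(i <oo) f i < +oo)%E.
Proof.
move=> f0 fM; apply: (@le_lt_trans _ _ M%:E); last exact: ltry.
by apply: lime_le; [exact: is_cvg_nneseries|exact: nearW].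
Qed.

Lemma nneseries_geometric_lty (f : nat -> \bar R) (C z : R) :
  0 <= C -> 0 <= z -> z < 1 ->
  (forall i, 0 <= f i)%E -> (forall i, f i <= (C * z ^+ i)%:E)%E ->
  (\sum_(i <oo) f i < +oo)%E.
Proof.
move=> C0 z0 z1 f0 fz; apply: (@nneseries_lty _ (C * (1 - z)^-1)) => // n.
apply: (@le_trans _ _ (\sum_(0 <= i < n) (C * z ^+ i)%:E)%E); first exact: lee_sum.
rewrite sumEFin lee_fin -mulr_sumr ler_wpM2l// big_mkord.
exact: geometric_sum_le.
Qed.

Lemma bernoulli_ineq (x : R) n : 0 <= x -> 1 + n%:R * x <= (1 + x) ^+ n.
Proof.
move=> x0; elim: n => [|n IH]; first by rewrite mul0r addr0 expr0.
rewrite exprS -natr1; apply: (@le_trans _ _ ((1 + x) * (1 + n%:R * x))); last first.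
  by rewrite ler_wpM2l// addr_ge0.
have : 0 <= n%:R * (x * x) by rewrite mulr_ge0// mulr_ge0.
by move=> h; lra.
Qed.

Lemma powR_exprn (x a : R) n : 0 <= x -> (x ^+ n) `^ a = (x `^ a) ^+ n.
Proof.
by move=> x0; rewrite -powR_mulrn// -powRrM mulrC powRrM powR_mulrn// powR_ge0.
Qed.

Lemma expRN_le_fact (y : R) k : 0 < y -> expR (- y) <= (k.+1)`!%:R / y ^+ k.+1.
Proof.
move=> y0; have := expR_ge1Dxn k (ltW y0) => h.
rewrite expRN -[leRHS]invrK lef_pV2 ?posrE ?expR_gt0 ?invr_gt0 ?divr_gt0 ?exprn_gt0 ?ltr0n ?fact_gt0//.
by rewrite invf_div (le_trans _ h)// lerDr.
Qed.

End series_bounds.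

Section fbm_holder.
Context {R : realType} {d : measure_display} {T : measurableType d}.
Variable P : probability T R.
Variables (H sigma : R) (W : R -> {RV P >-> R}).
Hypothesis W_fbm : fractional_brownian_motion H sigma W.
Hypotheses (H0 : 0 < H) (sigma0 : 0 < sigma).

(** Chernoff's bound at the parameter that scales the increment to variance 1, whence the [1/2] in
    the exponent. The exponential tail it gives is enough for a union bound over dyadic cells. *)
Lemma fbm_upper_tail (s t a : R) : s \in `[0, 1] -> t \in `[0, 1] -> s != t ->
  (P [set x | (a <= W t x - W s x)%R] <=
   (expR (2^-1 - a / (sigma * `|t - s| `^ H)))%:E)%E.
Proof.
move=> s01 t01 st.
have h0 : 0 < `|t - s| `^ H by rewrite powR_gt0// normr_gt0 subr_eq0 eq_sym.
set h := `|t - s| `^ H in h0 *.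
pose r := (sigma * h)^-1.
have r0 : 0 < r by rewrite invr_gt0 mulr_gt0.
have tt : s + (t - s) = t by ring.
pose X : {RV P >-> R} := (W t \- W s)%R.
have MX : ('M_P X r = (expR 2^-1)%:E)%E.
  have := @fbm_expR_increments _ _ _ P H sigma W W_fbm s (t - s) 0 r 0 H0 s01.
  rewrite tt addr0 => /(_ t01 s01) h1.
  rewrite /mmt_gen_fun unlock; transitivity
    (\int[P]_x (expR (r * (W t x - W s x) + 0 * (W s x - W s x)))%:E)%E.
    by apply: eq_integral => x _ /=; rewrite mul0r addr0 mulrC.
  rewrite h1; congr (expR _)%:E.
  rewrite expr0n/= !(mulr0,mul0r) !addr0 [2 * H]mulrC powRrM powR_mulrn ?powR_ge0//.
  rewrite -/h /r; field.
  by rewrite !gt_eqF.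
have := chernoff X a r0.
rewrite MX -EFinM -expRD => /le_trans; apply.
by rewrite lee_fin /r mulrC.
Qed.

Lemma fbm_tail (s t a : R) : s \in `[0, 1] -> t \in `[0, 1] -> s != t ->
  (P [set x | (a <= `|W t x - W s x|)%R] <=
   (2 * expR (2^-1 - a / (sigma * `|t - s| `^ H)))%:E)%E.
Proof.
move=> s01 t01 st.
have mset (u v : R) : measurable [set x | a <= W v x - W u x].
  have -> : [set x | a <= W v x - W u x] = (W v \- W u)%R @^-1` `[a, +oo[.
    by apply/seteqP; split => x /=; rewrite in_itv/= andbT.
  exact: (measurable_funPTI (W v \- W u)%R).
apply: (@le_trans _ _ (P ([set x | (a <= W t x - W s x)%R] `|` [set x | (a <= W s x - W t x)%R]))).
  apply: le_measure; rewrite ?inE.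
  - have -> : [set x | a <= `|W t x - W s x|] =
       [set x | a <= W t x - W s x] `|` [set x | a <= W s x - W t x].
      apply/seteqP; split => x /=; rewrite ler_normr opprB.
        by move=> /orP.
      by move=> [->|->]; rewrite ?orbT.
    exact: measurableU.
  - exact: measurableU.
  - move=> x /=; rewrite ler_normr opprB.
    by move=> /orP.
rewrite (le_trans (measureU2 _ (mset _ _) (mset _ _)))//.
have h1 := fbm_upper_tail a s01 t01 st.
have h2 : (P [set x | (a <= W s x - W t x)%R] <=
   (expR (2^-1 - a / (sigma * `|t - s| `^ H)))%:E)%E.
  by rewrite -(distrC s); apply: fbm_upper_tail => //; rewrite eq_sym.
rewrite (le_trans (leeD h1 h2))// -EFinD lee_fin.
lra.
Qed.

(** Borel-Cantelli over levels: at level [n] the normalized threshold is [b^n / sigma] with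
    [b = 2^(H - al) > 1], so the tail outweighs the [2^n] cells. *)
Lemma fbm_ae_dyadic (al : R) : al < H ->
  {ae P, forall x, exists n0 : nat, forall n i : nat, (n0 <= n)%N -> (i < 2 ^ n)%N ->
    `|W (i.+1%:R / 2 ^+ n) x - W (i%:R / 2 ^+ n) x| <= (2 `^ (- al)) ^+ n}.
Proof.
move=> alH; pose th : R := 2 `^ (- al); pose b : R := 2 `^ (H - al).
have th0 : 0 < th by rewrite powR_gt0.
pose B n i : set T := if (i < 2 ^ n)%N then
  [set x | th ^+ n <= `|W (i.+1%:R / 2 ^+ n) x - W (i%:R / 2 ^+ n) x|] else set0.
pose E n : set T := \big[setU/set0]_(i < 2 ^ n) B n i.
have mB n i : measurable (B n i).
  rewrite /B; case: ifP => // _.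
  have mf : measurable_fun setT (fun x => `|W (i.+1%:R / 2 ^+ n) x - W (i%:R / 2 ^+ n) x|).
    by apply: measurableT_comp => //; exact: measurable_funB.
  rewrite -[X in measurable X]setTI.
  have -> : [set x | th ^+ n <= `|W (i.+1%:R / 2 ^+ n) x - W (i%:R / 2 ^+ n) x|] =
    (fun x => `|W (i.+1%:R / 2 ^+ n) x - W (i%:R / 2 ^+ n) x|) @^-1` `[th ^+ n, +oo[.
    by apply/seteqP; split => x /=; rewrite in_itv/= andbT.
  exact: mf.
have mE n : measurable (E n) by exact: bigsetU_measurable.
have b1 : 1 < b.
  have := @powR2N_lt1 R (H - al); rewrite subr_gt0 => /(_ alH).
  by rewrite powRN invf_lt1 ?powR_gt0.
have b0 : 0 < b by rewrite (lt_trans ltr01).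
have PB n i : (P (B n i) <= (2 * expR (2^-1 - b ^+ n / sigma))%:E)%E.
  rewrite /B; case: ifPn => [i2|_]; last first.
    by rewrite measure0 lee_fin mulr_ge0// expR_ge0.
  have p2 : 0 < 2 ^+ n :> R by rewrite exprn_gt0.
  have d01 k : (k <= 2 ^ n)%N -> k%:R / 2 ^+ n \in `[0 : R, 1].
    move=> k2; rewrite in_itv/= divr_ge0 ?(ltW p2)//= ler_pdivrMr//.
    by rewrite mul1r -natrX ler_nat.
  have dd : i.+1%:R / 2 ^+ n - i%:R / 2 ^+ n = (2 ^+ n)^-1 :> R.
    by rewrite -mulrBl -natrB// subSnn mul1r.
  have ne : i%:R / 2 ^+ n != i.+1%:R / 2 ^+ n :> R.
    by rewrite -subr_eq0 -opprB dd oppr_eq0 invr_eq0 gt_eqF.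
  rewrite (le_trans (fbm_tail _ (d01 _ (ltnW i2)) (d01 _ i2) ne))//.
  rewrite lee_fin ler_pM2l// ler_expR lerD2l lerN2 dd ger0_norm ?invr_ge0 ?(ltW p2)//.
  suff -> : th ^+ n / (sigma * (2 ^+ n)^-1 `^ H) = b ^+ n / sigma by [].
  have -> : (2 ^+ n)^-1 `^ H = (2 `^ H ^+ n)^-1 :> R.
    by rewrite -powR_inv1 ?(ltW p2)// -powRrM mulN1r powRN powR_exprn.
  rewrite /th /b powRD; last by rewrite (_ : 2 != 0 :> R) ?implybT.
  rewrite exprMn; field.
  by rewrite gt_eqF//= gt_eqF// exprn_gt0// powR_gt0.
(* Since [exp(-y) <= (k+1)! / y^(k+1)], the tail at level [n] is O(4^-n): one factor [2^-n] pays for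
   the number of cells, the other is summable. *)
have [k bk] : exists k : nat, 4 <= b ^+ k.+1.
  have bb : 0 < b - 1 by rewrite subr_gt0.
  have [N hN] : exists N : nat, 4 < N%:R * (b - 1).
    exists (Num.bound (4 / (b - 1))); rewrite -ltr_pdivrMr//.
    by apply: archi_boundP; rewrite divr_ge0 ?(ltW bb).
  exists N; have := @bernoulli_ineq _ (b - 1) N.+1 (ltW bb).
  rewrite (_ : 1 + (b - 1) = b); last by ring.
  by apply: le_trans; rewrite -[N.+1%:R]natr1 mulrDl mul1r; lra.
have PE n : (P (E n) <= (2 * expR 2^-1 * (k.+1)`!%:R * sigma ^+ k.+1 * 2^-1 ^+ n)%:E)%E.
  rewrite (le_trans (Boole_inequality _ _))//.
  rewrite (@le_trans _ _ (\sum_(i < 2 ^ n) (2 * expR (2^-1 - b ^+ n / sigma))%:E)%E)//.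
    by apply: lee_sum => i _; exact: PB.
  rewrite sumEFin lee_fin sumr_const card_ord -[_ *+ (2 ^ n)%N]mulr_natl natrX.
  rewrite expRD (_ : _ * (2 * _) = 2 * expR 2^-1 * (2 ^+ n * expR (- (b ^+ n / sigma)))); last by ring.
  rewrite (_ : _ * 2^-1 ^+ n = 2 * expR 2^-1 * ((k.+1)`!%:R * (sigma ^+ k.+1 * 2^-1 ^+ n))); last by ring.
  rewrite ler_wpM2l ?mulr_ge0 ?expR_ge0//.
  have bn0 : 0 < b ^+ n by rewrite exprn_gt0.
  have := @expRN_le_fact R (b ^+ n / sigma) k; rewrite divr_gt0// => /(_ isT) h.
  rewrite (@le_trans _ _ (2 ^+ n * ((k.+1)`!%:R / (b ^+ n / sigma) ^+ k.+1)))//.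
    by rewrite ler_wpM2l// exprn_ge0.
  have -> : 2 ^+ n * ((k.+1)`!%:R / (b ^+ n / sigma) ^+ k.+1) =
     (k.+1)`!%:R * (sigma ^+ k.+1 * (2 ^+ n / (b ^+ k.+1) ^+ n)).
    rewrite expr_div_n -!exprM [(k.+1 * n)%N]mulnC; field.
    by rewrite gt_eqF ?exprn_gt0//= gt_eqF ?exprn_gt0.
  rewrite ler_wpM2l// ler_wpM2l ?exprn_ge0 ?(ltW sigma0)//.
  rewrite -expr_div_n.
  apply: lerXn2r; rewrite ?nnegrE ?divr_ge0 ?exprn_ge0 ?(ltW b0)//.
  rewrite ler_pdivrMr ?exprn_gt0//; lra.
have : (\sum_(n <oo) P (E n) < +oo)%E.
  apply: nneseries_geometric_lty PE => //; last by lra.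
  by rewrite !mulr_ge0 ?expR_ge0 ?exprn_ge0 ?(ltW sigma0).
move=> /(lim_sup_set_cvg0 mE) P0.
exists (lim_sup_set E); split => //.
  by apply: bigcapT_measurable => n; exact: bigcup_measurable.
move=> x /= hx n _; apply: contra_notP hx => /= hx.
exists n => m i nm i2; rewrite leNgt; apply/negP => h; apply: hx.
exists m => //=; rewrite /E -bigcup_mkord; exists i => //=.
by rewrite /B i2 /= ltW.
Qed.

End fbm_holder.

(** * Persistence probabilities *)

Section correlation.
Context {R : realType}.

(* [(i - j) + (j - i)] is the distance of [i] and [j]. *)
Lemma sum_geometric_dist_le (q : R) m i : 0 <= q -> q < 1 -> (i < m)%N ->
  \sum_(j < m) q ^+ ((i - j) + (j - i)) <= 2 / (1 - q).
Proof.
move=> q0 q1 im; have q10 : 0 < 1 - q by rewrite subr_gt0.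
rewrite -(big_mkord xpredT (fun j => q ^+ ((i - j) + (j - i)))).
rewrite (@big_cat_nat _ _ _ i)//=; last exact: ltnW.
have -> : 2 / (1 - q) = (1 - q)^-1 + (1 - q)^-1 by field; rewrite gt_eqF.
apply: lerD.
  rewrite big_nat_rev/= (@le_trans _ _ (\sum_(0 <= j < i) q ^+ j))//; last first.
    by rewrite big_mkord; exact: geometric_sum_le.
  rewrite [leLHS]big_nat [leRHS]big_nat; apply: ler_sum => j /andP[_ ji].
  have -> : ((i - (0 + i - j.+1)) + (0 + i - j.+1 - i))%N = j.+1 by lia.
  by rewrite exprS ler_piMl ?exprn_ge0// ltW.
rewrite -{1}(add0n i) big_addn (@le_trans _ _ (\sum_(0 <= j < m - i) q ^+ j))//; last first.
  by rewrite big_mkord; exact: geometric_sum_le.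
apply: ler_sum => j _.
by have -> : ((i - (j + i)) + (j + i - i))%N = j by lia.
Qed.

(* Correlation of the increments over [2 ^ -n] and [2 ^ -(n + l)], with
   [g = 2 ^ -H]; the last term is at least [g ^ (2 n) (1 - 2 ^ -l) ^ 2] because
   [2 H <= 2]. *)
Lemma fbm_correlation_le (H g : R) n l : 0 < H -> H < 1 -> g = 2^-1 `^ H ->
  (g ^+ n * g ^+ n + g ^+ (n + l) * g ^+ (n + l) -
     `|2^-1 ^+ n - 2^-1 ^+ (n + l)| `^ (2 * H)) / (2 * g ^+ n * g ^+ (n + l))
  <= 3 / 2 * Num.max g (2^-1 / g) ^+ l.
Proof.
move=> H0 H1 gE.
have g0 : 0 < g by rewrite gE powR_gt0.
have gn k : 0 < g ^+ k by rewrite exprn_gt0.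
set q := Num.max g _.
have qg : g <= q by rewrite le_max lexx.
have qg' : 2^-1 / g <= q by rewrite le_max lexx orbT.
have q0 : 0 < q by exact: lt_le_trans qg.
have l1 : 2^-1 ^+ l <= 1 :> R by rewrite exprn_ile1//; lra.
have l0 : 0 < 2^-1 ^+ l :> R by rewrite exprn_gt0.
have n0 : 0 < 2^-1 ^+ n :> R by rewrite exprn_gt0.
have D : g ^+ n * g ^+ n * (1 - 2 * 2^-1 ^+ l) <=
    `|2^-1 ^+ n - 2^-1 ^+ (n + l)| `^ (2 * H).
  have -> : 2^-1 ^+ n - 2^-1 ^+ (n + l) = 2^-1 ^+ n * (1 - 2^-1 ^+ l) :> R.
    by rewrite exprD mulrBr mulr1.
  rewrite ger0_norm ?mulr_ge0 ?subr_ge0 ?(ltW n0)//.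
  rewrite powRM ?subr_ge0 ?(ltW n0)//.
  have -> : (2^-1 ^+ n) `^ (2 * H) = g ^+ n * g ^+ n.
    by rewrite mulrC powRrM powR_mulrn ?powR_ge0// powR_exprn// -gE.
  rewrite ler_wpM2l// ?mulr_ge0 ?(ltW (gn _))//.
  have [->|ln1] := eqVneq (2^-1 ^+ l : R) 1.
    by rewrite (@le_trans _ _ 0)// ?powR_ge0//; lra.
  rewrite (@le_trans _ _ ((1 - 2^-1 ^+ l) ^+ 2))//.
    by have := sqr_ge0 (2^-1 ^+ l : R); rewrite !expr2; lra.
  rewrite -powR_mulrn ?subr_ge0//; apply: ger_powR; last lra.
  by rewrite subr_gt0 lt_neqAle ln1 l1/=; lra.
have -> : g ^+ (n + l) = g ^+ n * g ^+ l by rewrite exprD.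
rewrite ler_pdivrMr; last by rewrite !mulr_gt0.
(* After division the bound reads [g^l / 2 + 2^-l / g^l], at most [q^l / 2 + q^l]; this is the
   [3/2]. *)
have A1 : g ^+ l <= q ^+ l by apply: lerXn2r; rewrite ?nnegrE ?(ltW g0) ?(ltW q0).
have A2 : 2^-1 ^+ l <= q ^+ l * g ^+ l.
  rewrite -ler_pdivrMr// -expr_div_n.
  by apply: lerXn2r; rewrite ?nnegrE ?divr_ge0 ?(ltW g0) ?(ltW q0).
have gg : 0 < g ^+ n * g ^+ n by rewrite mulr_gt0.
apply: (@le_trans _ _ (g ^+ n * g ^+ n * (g ^+ l * g ^+ l + 2 * 2^-1 ^+ l))).
  have -> : g ^+ n * g ^+ l * (g ^+ n * g ^+ l) = g ^+ n * g ^+ n * (g ^+ l * g ^+ l) by ring.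
  move: D; set G := g ^+ n * g ^+ n; set D' := _ `^ _; set L := 2^-1 ^+ l.
  set B := g ^+ l * g ^+ l => D.
  lra.
have -> : 3 / 2 * q ^+ l * (2 * g ^+ n * (g ^+ n * g ^+ l)) =
   g ^+ n * g ^+ n * (3 * (q ^+ l * g ^+ l)) by field.
rewrite ler_wpM2l ?(ltW gg)//.
have : g ^+ l * g ^+ l <= q ^+ l * g ^+ l by rewrite ler_wpM2r// ltW.
by set a := g ^+ l * g ^+ l; set b := q ^+ l * g ^+ l in A2 *; lra.
Qed.

(** From [exp(-z) >= 1 - z] follows [exp z - 1 <= z exp z]. It turns a bound on correlations into
    one on covariances of exponentials; [3/2] is the largest value of the correlation bound. *)
Lemma expRB1_le (y z : R) : y <= z -> z <= 3 / 2 -> 0 <= z ->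
  expR y - 1 <= expR (3 / 2) * z.
Proof.
move=> yz z32 z0; have e0 := expR_gt0 z.
have h1 : expR y <= expR z by rewrite ler_expR.
have h2 : expR z <= expR (3 / 2) by rewrite ler_expR.
have : 1 - z <= expR (- z) by exact: expR_ge1Dx.
rewrite expRN => h3.
have : expR z * (1 - z) <= 1.
  by have := ler_wpM2l (ltW e0) h3; rewrite mulfV ?gt_eqF.
have : expR z * z <= expR (3 / 2) * z by rewrite ler_wpM2r.
lra.
Qed.

End correlation.

Section second_moment.
Context {R : realType} {d : measure_display} {T : measurableType d}.
Variable P : probability T R.

(** On [A] the centered sum of the [Z i] is at most [-m ka], so its square is at least [m^2 ka^2];
    the expectation of that square is the double sum of the covariances [r]. *)
Lemma chebyshev_sum m (Z : 'I_m -> T -> R) (r : 'I_m -> 'I_m -> R) (M ka : R) (A : set T) :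
  measurable A -> 0 < ka ->
  (forall i, measurable_fun setT (Z i)) ->
  (forall i, P.-integrable setT (EFin \o Z i)) ->
  (forall i j, P.-integrable setT (fun x => (Z i x * Z j x)%:E)) ->
  (forall i, \int[P]_x (Z i x)%:E = 1)%E ->
  (forall i j, \int[P]_x (Z i x * Z j x)%:E = (1 + r i j)%:E)%E ->
  \sum_(i < m) \sum_(j < m) r i j <= m%:R * M ->
  (forall x, A x -> forall i, Z i x <= 1 - ka) ->
  (P A * (m%:R ^+ 2 * ka ^+ 2)%:E <= (m%:R * M)%:E)%E.
Proof.
move=> mA ka0 mZ iZ iZZ EZ EZZ rM ZA.
pose S x := \sum_(i < m) (Z i x - 1).
have mS : measurable_fun setT S.
  by apply: measurable_sum => i; exact: measurable_funB.
pose h i j x := (Z i x * Z j x - Z i x - Z j x + 1)%:E.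
pose h' i j :=
  (((fun x => (Z i x * Z j x)%:E) \- (EFin \o Z i) \- (EFin \o Z j)) \+ cst 1)%E.
have ih i j : P.-integrable setT (h i j).
  apply: (eq_integrable _ (h' i j)) => //.
  apply: integrableD => //; last exact: finite_measure_integrable_cst.
  by apply: integrableB => //; exact: integrableB.
have E1 : (\int[P]_x (cst 1 x : \bar R) = 1)%E.
  by rewrite integral_cst// mul1e; exact: probability_setT.
have Eh i j : (\int[P]_x h i j x = (r i j)%:E)%E.
  rewrite (eq_integral (h' i j))//.
  rewrite integralD//; last 2 first.
  - by apply: integrableB => //; exact: integrableB.
  - exact: finite_measure_integrable_cst.
  rewrite integralB//; last exact: integrableB.
  rewrite integralB// EZZ !EZ E1.
  by rewrite -!EFinB -EFinD; congr EFin; ring.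
have S2E x : ((S x ^+ 2)%:E = \sum_(i < m) \sum_(j < m) h i j x)%E.
  under [RHS]eq_bigr do rewrite sumEFin.
  rewrite sumEFin; congr EFin; rewrite expr2 /S mulr_suml; apply: eq_bigr => i _.
  by rewrite mulr_sumr; apply: eq_bigr => j _; ring.
have ES : (\int[P]_x (S x ^+ 2)%:E = (\sum_(i < m) \sum_(j < m) r i j)%:E)%E.
  under eq_integral do rewrite S2E.
  rewrite integral_sum//; last first.
    by move=> i; exact: (@integrable_sum _ _ _ _ _ measurableT _ _ _ (h i)).
  rewrite -sumEFin; apply: eq_bigr => i _.
  by rewrite integral_sum// -sumEFin; apply: eq_bigr => j _.
apply: (@le_trans _ _ (\int[P]_x (S x ^+ 2)%:E)%E); last by rewrite ES lee_fin.
rewrite muleC -(setIT A) -integral_indic// -ge0_integralZl//; last 2 first.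
- exact/measurable_EFinP/measurable_indic.
- by rewrite lee_fin mulr_ge0// sqr_ge0.
apply: ge0_le_integral => //.
- by move=> x _; rewrite -EFinM lee_fin mulr_ge0// mulr_ge0 ?sqr_ge0.
- apply: emeasurable_funM => //; exact/measurable_EFinP/measurable_indic.
- by apply/measurable_EFinP; apply: measurable_funX.
move=> x _; rewrite -EFinM lee_fin indicE.
have [/set_mem Ax|_] := boolP (x \in A); last by rewrite mulr0 sqr_ge0.
rewrite mulr1 -exprMn -(sqrrN (S x)).
apply: lerXn2r; rewrite ?nnegrE.
- by rewrite mulr_ge0// ltW.
- rewrite oppr_ge0; apply: sumr_le0 => i _; have := ZA x Ax i; lra.
rewrite lerNr (@le_trans _ _ (\sum_(i < m) - ka))//.
  by apply: ler_sum => i _; have := ZA x Ax i; lra.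
by rewrite sumrN sumr_const card_ord lerN2 mulr_natl.
Qed.

End second_moment.

Section persistence.
Context {R : realType} {d : measure_display} {T : measurableType d}.
Variable P : probability T R.
Variables (H sigma : R) (W : R -> {RV P >-> R}).
Hypothesis W_fbm : fractional_brownian_motion H sigma W.
Hypotheses (H0 : 0 < H) (H1 : H < 1) (sigma0 : 0 < sigma).

(** With [X_j] the normalized increment, [Z_j = exp(-X_j - 1/2)] has mean 1 and covariances
    [exp(rho) - 1]. On the event every [Z_j] stays below 1 by a fixed amount, while the geometric
    decay of [rho] makes the variance of the sum O(m). *)
Lemma fbm_persistence : exists2 C : R, 0 < C & forall (s : R) (a m : nat),
  0 <= s <= 2^-1 -> (0 < a)%N -> (0 < m)%N ->
  (P [set x | forall j : nat, (j < m)%N ->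
     (- (sigma / 4 * (2^-1 `^ H) ^+ (a.+1 * m)) <=
      W (s + 2^-1 ^+ (a * m + j)) x - W s x)%R] <= (C / m%:R)%:E)%E.
Proof.
pose g : R := 2^-1 `^ H.
have g0 : 0 < g by rewrite powR_gt0.
have gp k : 0 < g ^+ k by rewrite exprn_gt0.
pose q := Num.max g (2^-1 / g).
have g1 : g < 1.
  by have := powR2N_lt1 H0; rewrite /g -powR_inv1// -powRrM mulN1r.
have g2 : 2^-1 < g.
  rewrite -[ltLHS]powRr1// /g -powR_inv1// -!powRrM !mulN1r !powRN.
  rewrite ltf_pV2 ?posrE ?powR_gt0//.
  have := @powR2N_lt1 R (1 - H); rewrite subr_gt0 => /(_ H1).
  rewrite opprB powRD ?implybT//; last by rewrite (_ : 2 != 0 :> R) ?implybT.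
  by rewrite powRN ltr_pdivrMr ?powR_gt0// mul1r.
have q1 : q < 1 by rewrite gt_max g1 ltr_pdivrMr ?mul1r.
have q0 : 0 < q by rewrite lt_max g0.
(* No drop below [-1/4] means [Z_j <= exp(1/4 - 1/2) = 1 - ka]. *)
pose ka : R := 1 - expR (- 4^-1).
have ka0 : 0 < ka by rewrite subr_gt0 expR_lt1; lra.
pose M := expR (3 / 2) * (3 / 2) * (2 / (1 - q)).
have M0 : 0 < M by rewrite !mulr_gt0 ?expR_gt0 ?invr_gt0 ?subr_gt0.
exists (M / ka ^+ 2) => [|s a m /andP[s0 s1] a0 m0].
  by rewrite divr_gt0// exprn_gt0.
set A := [set x | _].
pose n (j : nat) := (a * m + j)%N.
have n0 j : (0 < n j)%N by rewrite /n addn_gt0 muln_gt0 a0 m0.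
pose u j : R := 2^-1 ^+ n j.
have u0 j : 0 < u j by rewrite exprn_gt0.
(* The window starts at a positive exponent, so with [s <= 2^-1] all times stay in [[0, 1]]. *)
have u1 j : u j <= 2^-1.
  rewrite /u -(prednK (n0 j)) exprS ler_piMr// exprn_ile1//; lra.
have s01 : s \in `[0, 1] by rewrite in_itv/= s0/=; lra.
have su j : s + u j \in `[0, 1].
  by rewrite in_itv/=; have := u0 j; have := u1 j; move=> *; apply/andP; split; lra.
pose D j x := W (s + u j) x - W s x.
have mD j : measurable_fun setT (D j) by exact: measurable_funB.
pose c j : R := (sigma * g ^+ n j)^-1.
have c0 j : 0 < c j by rewrite invr_gt0 mulr_gt0.
pose Z (j : 'I_m) x := expR (- c j * D j x - 2^-1).
have mZ j : measurable_fun setT (Z j).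
  apply: measurableT_comp => //; apply: measurable_funB => //.
  exact: measurable_funM.
have u2H j : `|u j| `^ (2 * H) = g ^+ n j * g ^+ n j.
  by rewrite ger0_norm ?(ltW (u0 j))// mulrC powRrM powR_mulrn ?powR_ge0// powR_exprn// -/g.
pose rho (i j : nat) := (g ^+ n i * g ^+ n i + g ^+ n j * g ^+ n j -
     `|u i - u j| `^ (2 * H)) / (2 * g ^+ n i * g ^+ n j).
have EZZ i j : (\int[P]_x (Z i x * Z j x)%:E = (expR (rho i j))%:E)%E.
  have E x : (Z i x * Z j x)%:E = ((expR (- 1))%:E * (expR (- c i * D i x + - c j * D j x))%:E)%E.
    by rewrite -EFinM /Z -!expRD; congr (expR _)%:E; field.
  under eq_integral do rewrite E.
  rewrite ge0_integralZl//; last first.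
    apply/measurable_EFinP; apply: measurableT_comp => //.
    by apply: measurable_funD; exact: measurable_funM.
  rewrite (fbm_expR_increments W_fbm _ _ H0 s01 (su i) (su j)) !u2H -EFinM -expRD.
  congr (expR _)%:E; rewrite /rho /c; field.
  by rewrite !gt_eqF.
have EZ i : (\int[P]_x (Z i x)%:E = 1)%E.
  have E x : (Z i x)%:E = ((expR (- 2^-1))%:E * (expR (- c i * D i x + 0 * D i x))%:E)%E.
    by rewrite -EFinM /Z -!expRD; congr (expR _)%:E; ring.
  under eq_integral do rewrite E.
  rewrite ge0_integralZl//; last first.
    apply/measurable_EFinP; apply: measurableT_comp => //.
    by apply: measurable_funD; exact: measurable_funM.
  rewrite (fbm_expR_increments W_fbm _ _ H0 s01 (su i) (su i)) !u2H -EFinM -expRD.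
  rewrite -expR0; congr (expR _)%:E; rewrite /c; field.
  by rewrite !gt_eqF.
have iZ i : P.-integrable setT (EFin \o Z i).
  apply/integrableP; split; first exact/measurable_EFinP.
  under eq_integral do rewrite /= ger0_norm ?expR_ge0//.
  by rewrite EZ ltry.
have iZZ i j : P.-integrable setT (fun x => (Z i x * Z j x)%:E).
  apply/integrableP; split.
    by apply/measurable_EFinP; exact: measurable_funM.
  under eq_integral do rewrite /= ger0_norm ?mulr_ge0 ?expR_ge0//.
  by rewrite EZZ ltry.
have mA : measurable A.
  have -> : A = \bigcap_(j in `I_m)
     (D j @^-1` `[- (sigma / 4 * g ^+ (a.+1 * m)), +oo[).
    apply/seteqP; split => x /=.
      by move=> h j /= jm; rewrite /= in_itv/= andbT; exact: h.
    by move=> h j jm; have := h j jm; rewrite /= in_itv/= andbT.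
  apply: bigcap_measurable => [|j _]; first by exists 0%N.
  by rewrite -[X in measurable X]setTI; exact: mD.
have rho_sym i j : rho i j = rho j i.
  rewrite /rho distrC; congr (_ / _); ring.
have rho_le (i j : nat) : rho i j <= 3 / 2 * q ^+ ((i - j) + (j - i)).
  wlog ij : i j / (i <= j)%N.
    by move=> hw; case/orP: (leq_total i j) => /hw //; rewrite rho_sym addnC.
  have -> : ((i - j) + (j - i) = j - i)%N by rewrite (eqP (ij : (i - j == 0)%N)).
  have nij : (n i + (j - i) = n j)%N by rewrite /n -addnA subnKC.
  by have := @fbm_correlation_le R H g (n i) (j - i) H0 H1 erefl; rewrite nij.
have key : (P A * (m%:R ^+ 2 * ka ^+ 2)%:E <= (m%:R * M)%:E)%E.
  apply: (@chebyshev_sum _ _ _ P m Z (fun i j => expR (rho i j) - 1)) => //.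
  - by move=> i j; rewrite EZZ; congr EFin; ring.
  - have -> : m%:R * M = \sum_(i < m) M by rewrite sumr_const card_ord mulr_natl.
    apply: ler_sum => i _.
    rewrite (@le_trans _ _ (\sum_(j < m) expR (3 / 2) * (3 / 2) * q ^+ ((i - j) + (j - i))))//.
      apply: ler_sum => j _; rewrite -mulrA; apply: expRB1_le => //.
        by rewrite ler_piMr// exprn_ile1// ltW.
      by rewrite mulr_ge0// exprn_ge0// ltW.
    rewrite -mulr_sumr ler_wpM2l ?mulr_ge0 ?expR_ge0//.
    by apply: sum_geometric_dist_le => //; exact: ltW.
  - move=> x Ax i; rewrite /ka opprB addrC subrK ler_expR.
    have := Ax i (ltn_ord i); rewrite -/g -/(n i) -/(u i) -/(D i x) => h.
    have : - c i * D i x <= 4^-1.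
      rewrite mulNr lerNl.
      have h2 : c i * (- (sigma / 4 * g ^+ (a.+1 * m))) <= c i * D i x by rewrite ler_pM2l.
      apply: le_trans h2; rewrite mulrN lerN2 /c.
      have -> : (sigma * g ^+ n i)^-1 * (sigma / 4 * g ^+ (a.+1 * m)) =
          4^-1 * (g ^+ (a.+1 * m) / g ^+ n i).
        by field; rewrite !gt_eqF.
      (* The threshold belongs to the finest scale [a.+1 * m]; relative to a coarser scale of the
         window it is at most [1/4]. *)
      rewrite ler_piMr// ler_pdivrMr// mul1r.
      rewrite ler_wiXn2l ?(ltW g0) ?(ltW g1)// /n mulSn.
      by rewrite addnC leq_add2r ltnW.
    lra.
have m0' : 0 < m%:R :> R by rewrite ltr0n.
have fA : P A \is a fin_num by exact: fin_num_measure.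
move: key; rewrite -(fineK fA) -EFinM !lee_fin => key.
rewrite ler_pdivlMr// ler_pdivlMr ?exprn_gt0//.
rewrite -(ler_pM2l m0'); rewrite expr2 in key.
by apply: le_trans key; rewrite le_eqVlt; apply/orP; left; apply/eqP; ring.
Qed.

End persistence.

(** * Times of rapid descent *)

Section joint_measurability.
Context {R : realType} {d : measure_display} {T : measurableType d}.
Local Notation TR := (measurableTypeR R).

(** Rounding time down to multiples of [1 / n.+1] gives maps whose preimages are countable unions of
    measurable rectangles; they converge pointwise by continuity in time. *)
Lemma measurable_continuous_process (V : R -> T -> R) :
  (forall t, measurable_fun setT (V t)) -> (forall x, continuous (V^~ x)) ->
  measurable_fun [set: TR * T] (fun z => V z.1 z.2).
Proof.
move=> mV cV.
pose r n (t : R) : R := (Num.floor (n.+1%:R * t))%:~R / n.+1%:R.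
apply: (@measurable_fun_cvg _ _ _ _ (fun n (z : TR * T) => V (r n z.1) z.2)).
  move=> n _ B mB; rewrite setTI.
  have -> : (fun z : TR * T => V (r n z.1) z.2) @^-1` B =
     \bigcup_(k : int) ([set t : TR | k%:~R <= n.+1%:R * t < (k + 1)%:~R] `*`
        (V (k%:~R / n.+1%:R) @^-1` B)).
    apply/seteqP; split => [[t x] /= Bz|[t x] [k _ [/= hk Bz]]].
      by exists (Num.floor (n.+1%:R * t)) => //; split => //=; exact: floor_itv.
    by rewrite /r (floor_def hk).
  apply: countable_bigcupT_measurable => // k; apply: measurableX.
    have -> : [set t : TR | k%:~R <= n.+1%:R * t < (k + 1)%:~R] =
        `[k%:~R / n.+1%:R, (k + 1)%:~R / n.+1%:R[%classic.
      apply/seteqP; split => t /=; rewrite in_itv/= ler_pdivrMr// ltr_pdivlMr//;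
      by rewrite mulrC.
    exact: measurable_itv.
  by rewrite -[X in measurable X]setTI; exact: mV.
move=> [t x] _ /=.
apply: (@cvg_comp _ _ _ (fun n => r n t) (V^~ x) _ (nbhs t)); last exact: cV.
apply/cvgrPdist_le => e e0; near=> n.
have n0 : 0 < n.+1%:R :> R by rewrite ltr0n.
have /andP[h1 h2] := floor_itv (n.+1%:R * t).
rewrite /r ler_norml; apply/andP; split.
  rewrite (@le_trans _ _ 0)//; first by rewrite oppr_le0 ltW.
  by rewrite subr_ge0 ler_pdivrMr// [t * _]mulrC.
have : e^-1 <= n.+1%:R.
  near: n; exists (Num.bound e^-1) => // n /= hn.
  apply: ltW; apply: lt_le_trans (archi_boundP _) _; first by rewrite invr_ge0 ltW.
  by rewrite ler_nat (leq_trans hn).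
rewrite -[e^-1 <= _]lef_pV2 ?posrE ?invr_gt0// invrK; apply: le_trans.
rewrite lerBlDr -[X in X + _]mul1r -mulrDl ler_pdivlMr// mulrC.
rewrite (le_trans (ltW h2))//.
by rewrite intrD addrC.
Unshelve. all: by end_near. Qed.

(** Composition with this retraction makes a path that is continuous on [[0, 1]] continuous on the
    whole line, since [W t] is arbitrary for other [t]. *)
Definition clamp01 (t : R) : R := Num.max 0 (Num.min t 1).

Lemma clamp01_itv t : clamp01 t \in `[0, 1].
Proof. by rewrite in_itv/= le_max lexx/= ge_max ler01 ge_min lexx orbT. Qed.

Lemma clamp01_id t : 0 <= t <= 1 -> clamp01 t = t.
Proof. by move=> /andP[t0 t1]; rewrite /clamp01 (min_idPl t1) (max_idPr t0). Qed.

Lemma continuous_clamp01 : continuous clamp01.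
Proof.
move=> t; have h : {for t, continuous ((fun u : R => u : R^o) \min cst (1 : R^o))}.
  by apply: (@continuous_min R R); [exact: cvg_id|exact: cvg_cst].
by apply: (@continuous_max R R (cst 0) _ t) => //; exact: cvg_cst.
Qed.

Lemma continuous_comp_clamp01 (w : R -> R) : {within `[0, 1], continuous w} ->
  continuous (w \o clamp01).
Proof.
move=> /subspace_continuousP wc t; have := wc (clamp01 t) (clamp01_itv t).
move=> h; apply: (@cvg_comp _ _ _ clamp01 w _ _ _ _ h).
move=> B hB.
have h2 : nbhs t (clamp01 @^-1` [set y | `[0, 1]%classic y -> B y]).
  exact: (@continuous_clamp01 t).
by apply: filterS h2 => y /=; apply; exact: clamp01_itv.
Qed.

End joint_measurability.

Section null_sections.
Context {R : realType} {d1 d2 : measure_display}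
  {T1 : measurableType d1} {T2 : measurableType d2}.
Variables (m1 : {sigma_finite_measure set T1 -> \bar R})
  (m2 : {sigma_finite_measure set T2 -> \bar R}).

Lemma ae_null_ysection (A : set (T1 * T2)) : measurable A ->
  ((m1 \x m2) A = 0)%E -> {ae m2, forall y, m1 (ysection A y) = 0%E}.
Proof.
move=> mA A0.
have mf : measurable_fun setT (EFin \o (\1_A : T1 * T2 -> R)).
  exact/measurable_EFinP/measurable_indic.
have f0 (z : T1 * T2) : (0 <= (EFin \o (\1_A : T1 * T2 -> R)) z)%E by rewrite lee_fin.
have := fubini_tonelli2 (m1 := m1) (m2 := m2) _ mf f0.
rewrite [LHS](_ : _ = 0%E); last by rewrite integral_indic// setIT; exact: A0.
move=> /esym.
rewrite indic_fubini_tonelli_GE// => h.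
have mg : measurable_fun [set: T2] (m1 \o ysection A).
  by rewrite -indic_fubini_tonelli_GE//; exact: measurable_fun_fubini_tonelli_G.
have /(ae_eq_integral_abs m2 measurableT mg) : (\int[m2]_x `|(m1 \o ysection A) x| = 0)%E.
  by rewrite -[RHS]h; apply: eq_integral => x _; rewrite gee0_abs// measure_ge0.
by apply: filterS => y /(_ I).
Qed.

End null_sections.

Section good_times.
Context {R : realType} {d : measure_display} {T : measurableType d}.
Variable P : probability T R.
Variables (H sigma : R) (W : R -> {RV P >-> R}).
Hypothesis W_fbm : fractional_brownian_motion H sigma W.
Hypotheses (H0 : 0 < H) (H1 : H < 1) (sigma0 : 0 < sigma).
Hypothesis W_cont : {ae P, forall x, {within `[0, 1], continuous (fun t => W t x)}}.

(* The persistence bound [C / m] is summable along [m = (k + 1) (k + 2)], while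
   consecutive scales [2 ^ -(a m)] keep comparable exponents. *)
Definition scale (k : nat) := (k.+1 * k.+2)%N.

(** The sum telescopes: each term is [1/(k+1) - 1/(k+2)]. *)
Lemma sum_scaleV n : \sum_(0 <= k < n) (scale k)%:R^-1 <= 1 :> R.
Proof.
suff -> : \sum_(0 <= k < n) (scale k)%:R^-1 = 1 - n.+1%:R^-1 :> R.
  by rewrite gerBl invr_ge0.
elim: n => [|n IH]; first by rewrite big_nil invr1 subrr.
rewrite big_nat_recr//= IH /scale natrM -[n.+2%:R]natr1.
have : 0 < n.+1%:R :> R by rewrite ltr0n.
move: n.+1%:R => b b0; field.
by rewrite !gt_eqF// addr_gt0.
Qed.

(** A quarter of the standard deviation of an increment over [2^-(a.+1 * scale k)], the fine end of
    the [k]-th window. *)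
Definition drop_depth (a k : nat) : R := sigma / 4 * (2^-1 `^ H) ^+ (a.+1 * scale k).

(** Borel-Cantelli is applied on the product of time and probability space, since the persistence
    bound is uniform in [s]. By Tonelli, for almost every path almost every time lies in finitely
    many bad sets. *)
Lemma fbm_ae_good (a : nat) : (0 < a)%N ->
  {ae P, forall x, exists (G : set R) (i : nat),
    [/\ measurable G, G `<=` `[0, 2^-1], (0 < lebesgue_measure G)%E &
      forall s k, G s -> (i <= k)%N -> exists2 j : nat, (j < scale k)%N &
        W (s + 2^-1 ^+ (a * scale k + j)) x - W s x < - drop_depth a k]}.
Proof.
move=> a0; have [C C0 HC] := fbm_persistence W_fbm H0 H1 sigma0.
have [N [mN N0 WN]] := W_cont.
(* Clamping time and killing the paths in the null set [N] makes every path continuous on the line,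
   which joint measurability requires. *)
pose V (t : R) (x : T) : R := W (clamp01 t) x * \1_(~` N) x.
have mV t : measurable_fun setT (V t).
  by apply: measurable_funM => //; apply: measurable_indic; exact: measurableC.
have cV x : continuous (V^~ x).
  have [xN|xN] := pselect (N x).
    have -> : V^~ x = cst 0; last by move=> t; exact: cvg_cst.
    by apply/funext => t; rewrite /V indicE memNset ?mulr0// => /(_ xN).
  have -> : V^~ x = (W^~ x : R -> R) \o clamp01.
    by apply/funext => t; rewrite /V indicE mem_set ?mulr1.
  apply: continuous_comp_clamp01; apply: contrapT => h; exact/xN/WN.
have mVV := measurable_continuous_process mV cV.
have mVu (u : R) : measurable_fun [set: measurableTypeR R * T] (fun z => V (z.1 + u) z.2).
  apply: (@measurable_continuous_process _ _ _ (fun t => V (t + u))) => // x t.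
  apply: (@continuous_comp _ _ _ (fun t => t + u) (V^~ x)); last exact: cV.
  by apply: cvgD; [exact: cvg_id|exact: cvg_cst].
pose rho := drop_depth a.
pose u k j : R := 2^-1 ^+ (a * scale k + j).
pose Bad k : set (measurableTypeR R * T) := (`[0, 2^-1]%classic `*` setT) `&`
   \bigcap_(j in `I_(scale k)) [set z | - rho k <= V (z.1 + u k j) z.2 - V z.1 z.2].
have mBad k : measurable (Bad k).
  apply: measurableI; first by apply: measurableX => //; exact: measurable_itv.
  apply: bigcap_measurable => [|j _]; first by exists 0%N.
  have -> : [set z : measurableTypeR R * T | - rho k <= V (z.1 + u k j) z.2 - V z.1 z.2] =
    (fun z : measurableTypeR R * T => V (z.1 + u k j) z.2 - V z.1 z.2) @^-1` `[- rho k, +oo[.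
    by apply/seteqP; split => z /=; rewrite in_itv/= andbT.
  rewrite -[X in measurable X]setTI.
  by apply: (measurable_funB (mVu (u k j)) mVV) => //; exact: measurable_itv.
pose mu := @lebesgue_measure R.
have muI : mu `[0%R, 2^-1]%classic = (2^-1)%:E.
  by rewrite /mu lebesgue_measure_itv/= lte_fin invr_gt0 ltr0n/= oppr0 adde0.
have scale0 k : (0 < scale k)%N by [].
have u01 k j (s : R) : 0 <= s <= 2^-1 -> 0 <= s + u k j <= 1.
  move=> /andP[s0 s1]; have u0 : 0 < u k j by rewrite exprn_gt0.
  have u1 : u k j <= 2^-1.
    have : (0 < a * scale k + j)%N by rewrite addn_gt0 muln_gt0 a0.
    rewrite /u; case: (_ + _)%N => // n _.
    by rewrite exprS ler_piMr// exprn_ile1//; lra.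
  by apply/andP; split; lra.
have VW x s k j : ~ N x -> 0 <= s <= 2^-1 ->
    V (s + u k j) x - V s x = W (s + u k j) x - W s x.
  move=> xN s01; rewrite /V indicE mem_set// !mulr1 !clamp01_id//.
    by case/andP: s01 => ? ?; apply/andP; split; lra.
  exact: u01.
have PBad k s : (P (xsection (Bad k) s) <=
    (C / (scale k)%:R)%:E * (\1_(`[0%R, 2^-1]%classic : set R) s)%:E)%E.
  rewrite indicE; have [/set_mem s01|s01] := boolP (s \in `[0%R, 2^-1]%classic); last first.
    rewrite (_ : xsection _ _ = set0) ?measure0 ?mule0//.
    by apply/seteqP; split => x // /xsectionP[[]]; move/negP: s01; rewrite inE.
  rewrite mule1; have s01' : 0 <= s <= 2^-1 by move: s01; rewrite /= in_itv.
  apply: le_trans (HC s a (scale k) s01' a0 (scale0 k)).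
  set A := [set x | _].
  have mA : measurable A.
    have -> : A = \bigcap_(j in `I_(scale k))
       ((W (s + u k j) \- W s)%R @^-1` `[- rho k, +oo[).
      apply/seteqP; split => x /=.
        by move=> h j /= jm; rewrite /= in_itv/= andbT; exact: h.
      by move=> h j jm; have := h j jm; rewrite /= in_itv/= andbT.
    apply: bigcap_measurable => [|j _]; first by exists 0%N.
    exact: (measurable_funPTI (W (s + u k j) \- W s)%R).
  have mX : measurable (xsection (Bad k) s) by exact: measurable_xsection.
  apply: (@le_trans _ _ (P (N `|` A))).
    apply: le_measure; rewrite ?inE//; first exact: measurableU.
    move=> x /xsectionP[_ h]; have [xN|xN] := pselect (N x); [by left|right].
    by move=> j jm; have := h j jm; rewrite /= VW.
  rewrite (le_trans (measureU2 _ mN mA))//.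
  by rewrite [X in (X + _ <= _)%E](_ : _ = 0%E) ?add0e//; exact: N0.
have muBad k : ((mu \x P) (Bad k) <= (C / (scale k)%:R)%:E)%E.
  apply: (@le_trans _ _ (\int[mu]_s
      ((C / (scale k)%:R)%:E * (\1_(`[0%R, 2^-1]%classic : set R) s)%:E))%E).
    apply: ge0_le_integral => //.
    - exact: measurable_fun_xsection.
    - by apply: emeasurable_funM => //; apply/measurable_EFinP/measurable_indic; exact: measurable_itv.
    - by move=> s _; exact: PBad.
  rewrite ge0_integralZl//; last 2 first.
  - by apply/measurable_EFinP/measurable_indic; exact: measurable_itv.
  - by rewrite lee_fin divr_ge0// ltW.
  rewrite [X in (_ * X)%E](_ : _ = (2^-1)%:E); last first.
    by rewrite integral_indic// setIT; exact: muI.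
  by rewrite -EFinM lee_fin ler_piMr ?divr_ge0 ?(ltW C0)// invf_le1// ler1n.
have sumBad : (\sum_(k <oo) (mu \x P) (Bad k) < +oo)%E.
  apply: (@nneseries_lty _ _ C) => // n.
  apply: (@le_trans _ _ (\sum_(0 <= k < n) (C / (scale k)%:R)%:E)%E).
    by apply: lee_sum => k _; exact: muBad.
  rewrite sumEFin lee_fin -mulr_sumr ler_piMr ?(ltW C0)//.
  exact: sum_scaleV.
have := lim_sup_set_cvg0 mBad sumBad.
set L := lim_sup_set Bad => muL.
have mL : measurable L.
  by apply: bigcapT_measurable => n; exact: bigcup_measurable.
have aeL := ae_null_ysection mL muL.
have aeN : {ae P, forall x, ~ N x} by exists N; split => // x /= /contrapT.
move: aeL aeN; apply: filterS2 => x Lx xN.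
pose G i := [set s : R | 0 <= s <= 2^-1] `&` ~` \bigcup_(k >= i) ysection (Bad k) x.
have mi : measurable [set s : measurableTypeR R | 0 <= s <= 2^-1].
  rewrite (_ : mkset _ = `[0, 2^-1]%classic); first exact: measurable_itv.
  by apply/seteqP; split => s /=; rewrite in_itv.
have mG i : measurable (G i : set (measurableTypeR R)).
  apply: measurableI => //; apply: measurableC; apply: bigcup_measurable => k _.
  exact: (measurable_ysection x (mBad k)).
(* The [G i] cover [[0, 1/2]] up to the null section of [L]; were all of them null, so would be the
   interval. *)
have [i Gi] : exists i, (0 < mu (G i))%E.
  apply: contrapT => /forallNP hG.
  have G0 i : mu (G i) = 0%E.
    by apply/eqP; rewrite eq_le measure_ge0 andbT leNgt; apply/negP; exact: hG.
  have : (mu `[0%R, (2^-1)%R]%classic <= mu (ysection L x) + \sum_(i <oo) mu (G i))%E.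
    apply: (@le_trans _ _ (mu (ysection L x `|` \bigcup_i G i))).
      apply: le_measure; rewrite ?inE//.
        apply: measurableU; first exact: measurable_ysection.
        exact: bigcup_measurable.
      move=> s s01; have [Ls|Ls] := pselect (ysection L x s); [by left|right].
      have : ~ L (s, x) by move=> h; apply: Ls; exact/ysectionP.
      rewrite /L /lim_sup_set => /existsNP[i /not_implyP[_ hi]].
      exists i => //; split; first by move: s01; rewrite /= in_itv.
      move=> [k /= ik Bk]; apply: hi; exists k => //; exact/ysectionP.
    rewrite (le_trans (measureU2 _ _ _))//; first exact: measurable_ysection.
      exact: bigcup_measurable.
    apply: leeD => //; apply: generalized_Boole_inequality => //.
    exact: bigcup_measurable.
  rewrite [X in (_ <= X + _)%E](_ : _ = 0%E); last exact: Lx.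
  rewrite add0e eseries0; last by move=> *; exact: G0.
  by rewrite muI lee_fin leNgt invr_gt0 ltr0n.
exists (G i), i; split => //.
- exact: (mG i).
- by move=> s [s01 _].
move=> s k [s01 Gs] ik; apply: contrapT => h; apply: Gs.
exists k => //; apply/ysectionP; split; first by split => //=; rewrite in_itv.
move=> j /= jm; rewrite VW// leNgt; apply/negP => hj; apply: h.
by exists j.
Qed.

End good_times.

Section good_paths.
Context {R : realType}.
Variables (w : R -> R) (H sigma : R) (a i : nat) (G : set R).
Hypotheses (wc : {within `[0, 1], continuous w}) (H0 : 0 < H) (sigma0 : 0 < sigma).
Hypotheses (a0 : (0 < a)%N) (mG : measurable G) (G01 : G `<=` `[0, 2^-1])
  (G0 : (0 < lebesgue_measure G)%E).
Hypothesis Gdrop : forall s k, G s -> (i <= k)%N ->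
  exists2 j : nat, (j < scale k)%N &
    w (s + 2^-1 ^+ (a * scale k + j)) - w s < - drop_depth H sigma a k.

(** If [delta(s, t)] lies between the depths of windows [k.+1] and [k], then
    [t - s < 2^-(a scale k)], while the [gam]-th power of the smaller depth is a constant times
    [2^-(gam H (a+1) scale(k+1))]. The condition on [gam] leaves room for the ratio of consecutive
    scales. *)
Lemma tree_dim_ge_good (gam : R) : 0 < gam -> gam * H * a.+1%:R < a%:R ->
  (gam%:E <= hausdorff_dim [set: tree wc])%E.
Proof.
move=> gam0; set ka := gam * H * _ => kaa.
have ka0 : 0 < ka by rewrite !mulr_gt0.
have dka : 0 < a%:R - ka by rewrite subr_gt0.
(* The ratio of consecutive scales is [(k+3)/(k+1)]; [ka (k+3) <= a (k+1)] holds as soon as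
   [(a - ka) k >= 3 ka]. *)
have [i1 hi1] : exists i1 : nat, forall k : nat, (i1 <= k)%N ->
    ka * (scale k.+1)%:R <= a%:R * (scale k)%:R.
  exists (Num.bound (3 * ka / (a%:R - ka))) => k hk.
  have : 3 * ka / (a%:R - ka) <= k%:R.
    apply: ltW; apply: lt_le_trans (archi_boundP _) _.
      by apply: divr_ge0; [apply: mulr_ge0 => //; exact: ltW|exact: ltW].
    by rewrite ler_nat.
  rewrite ler_pdivrMr// /scale !natrM => h.
  have -> : ka * (k.+2%:R * k.+3%:R) = k.+2%:R * (ka * k.+3%:R) by ring.
  have -> : a%:R * (k.+1%:R * k.+2%:R) = k.+2%:R * (a%:R * k.+1%:R) :> R by ring.
  rewrite ler_pM2l ?ltr0n// -[k.+3%:R]natr1 -[k.+2%:R]natr1 -[k.+1%:R]natr1.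
  have : 0 < a%:R :> R by rewrite ltr0n.
  lra.
pose i0 := maxn i i1.
pose rho k := drop_depth H sigma a k.
have g0 : 0 < 2^-1 `^ H :> R by rewrite powR_gt0.
have rho0 k : 0 < rho k by rewrite /rho /drop_depth mulr_gt0 ?divr_gt0 ?exprn_gt0.
have s40 : 0 < sigma / 4 by rewrite divr_gt0.
have G1 s : G s -> 0 <= s /\ s <= 1.
  by move=> /G01; rewrite /= in_itv/= => /andP[s0 s1]; split=> //; lra.
(* Otherwise the drop promised at [s] would occur before [t] and force the distance above
   [rho k]. *)
have close s t k : G s -> G t -> s < t -> (i <= k)%N -> tree_semidist w s t < rho k ->
    t - s < 2^-1 ^+ (a * scale k).
  move=> Gs Gt st ik dk; have [j jk hj] := Gdrop Gs ik.
  have u0 : 0 < 2^-1 ^+ (a * scale k + j) :> R by rewrite exprn_gt0.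
  have u1 : 2^-1 ^+ (a * scale k + j) <= 2^-1 ^+ (a * scale k) :> R.
    by rewrite ler_wiXn2l// ?leq_addr//; lra.
  rewrite ltNge; apply/negP => h.
  have [s0 _] := G1 _ Gs; have [_ t1] := G1 _ Gt.
  have : s <= s + 2^-1 ^+ (a * scale k + j) <= t.
    by apply/andP; split; lra.
  by move=> /(tree_semidist_ge wc s0 t1); rewrite /rho in dk; lra.
apply: (@tree_dim_ge _ _ wc G gam ((sigma / 4) `^ (- gam)) (rho i0)) => //.
- by rewrite powR_gt0.
- by move=> s /G1[s0 s1]; rewrite /= in_itv/= s0.
move=> s t Gs Gt st dr.
set del := tree_semidist w s t in dr *.
(* If [del] were below every depth, [close] would give [t - s < 2^-k] for arbitrarily large [k]. *)
have exk : exists k, (i0 <= k)%N && (rho k <= del).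
  have ts0 : 0 < t - s by rewrite subr_gt0.
  pose k := maxn i0 (Num.bound (t - s)^-1).
  exists k; rewrite leq_maxl/= leNgt; apply/negP => /(close _ _ _ Gs Gt st) h.
  have ik : (i <= k)%N by rewrite (leq_trans _ (leq_maxl _ _))// leq_maxl.
  have {h} := h ik; apply/negP; rewrite -leNgt.
  apply: (@le_trans _ _ (2^-1 ^+ k)).
    rewrite ler_wiXn2l//; [lra|].
    rewrite /scale -[X in (X <= _)%N]mul1n leq_mul//.
    by rewrite -[X in (X <= _)%N]muln1 leq_mul.
  rewrite exprVn -[leRHS]invrK lef_pV2 ?posrE ?invr_gt0 ?exprn_gt0//.
  apply: (@le_trans _ _ k%:R); last by rewrite -natrX ler_nat ltnW// ltn_expl.
  apply: ltW; apply: lt_le_trans (archi_boundP _) _; first by rewrite invr_ge0 ltW.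
  by rewrite ler_nat leq_maxr.
case: (ex_minnP exk) => k /andP[i0k rk] kmin.
(* The least such [k] is not [i0], because [del < rho i0]; so its predecessor is an admissible
   window of depth greater than [del]. *)
have : (i0 < k)%N.
  rewrite ltn_neqAle i0k andbT; apply/eqP => e; move: rk; rewrite -e leNgt.
  by rewrite dr.
case: k i0k rk kmin => // k _ rk kmin; rewrite ltnS => i0k.
have dk : del < rho k.
  rewrite ltNge; apply/negP => h; have := kmin k; rewrite i0k h => /(_ isT).
  by rewrite ltnn.
have ik : (i <= k)%N by rewrite (leq_trans _ i0k)// leq_maxl.
have i1k : (i1 <= k)%N by rewrite (leq_trans _ i0k)// leq_maxr.
rewrite (le_trans (ltW (close _ _ _ Gs Gt st ik dk)))//.
apply: (@le_trans _ _ ((sigma / 4) `^ (- gam) * rho k.+1 `^ gam)); last first.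
  rewrite ler_wpM2l ?powR_ge0//; apply: ge0_ler_powR; rewrite ?nnegrE ?(ltW gam0) ?(ltW (rho0 _))//.
  exact: le_trans (ltW (rho0 _)) rk.
rewrite /rho /drop_depth [X in _ <= _ * X]powRM ?exprn_ge0 ?(ltW g0) ?(ltW s40)//.
rewrite mulrA powRN mulVf ?mul1r ?gt_eqF ?powR_gt0//.
rewrite -powR_mulrn// -powR_mulrn ?(ltW g0)// -!powRrM.
apply: ger_powR; first by rewrite invr_gt0 ltr0n/= invf_le1// ler1n.
have := hi1 k i1k; rewrite /ka /scale !natrM => h.
by apply: le_trans h; rewrite le_eqVlt; apply/orP; left; apply/eqP; ring.
Qed.

End good_paths.

(** * Limits of the exponents along countable families *)

Unset Implicit Arguments.
Set Strict Implicit.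
Set Printing Implicit Defensive.

Theorem proposition3p6 (R : realType) (d : measure_display)
    (T : measurableType d) (P : probability T R)
    (H sigma : R) (W : R -> {RV P >-> R})
    (H_gt0 : 0 < H) (H_lt1 : H < 1) (sigma_gt0 : 0 < sigma)
    (W_fbm : fractional_brownian_motion H sigma W)
    (W_cont : {ae P, forall x, {within `[0, 1], continuous (fun t => W t x)}}) :
  {ae P, forall x,
    exists wc : {within `[0, 1], continuous (fun t => W t x)},
      hausdorff_dim [set: tree wc] = variation_index (fun t => W t x) /\
      variation_index (fun t => W t x) = (1 / H)%:E}.
Proof.
have H1_gt0 : 0 < 1 / H by rewrite divr_gt0.
(* A sequence increasing to [H], so that countably many almost sure events suffice; [1 / al n]
   exceeds [1 / H] by [1 / (H n.+1)]. *)
pose al (n : nat) : R := H * (n.+1%:R / n.+2%:R).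
have al_gt0 n : 0 < al n by rewrite mulr_gt0 ?divr_gt0 ?ltr0n.
have al_lt n : al n < H.
  by rewrite /al -[ltRHS]mulr1 ltr_pM2l// ltr_pdivrMr ?ltr0n// mul1r ltr_nat.
have dyadic : {ae P, forall x, forall n, exists n0 : nat, forall m i : nat,
    (n0 <= m)%N -> (i < 2 ^ m)%N ->
    `|W (i.+1%:R / 2 ^+ m) x - W (i%:R / 2 ^+ m) x| <= (2 `^ (- al n)) ^+ m}.
  apply: ae_foralln => n.
  exact: (fbm_ae_dyadic W_fbm H_gt0 sigma_gt0 (al_lt n)).
have good : {ae P, forall x, forall n, exists (G : set R) (i : nat),
    [/\ measurable G, G `<=` `[0, 2^-1], (0 < lebesgue_measure G)%E &
      forall s k, G s -> (i <= k)%N -> exists2 j : nat, (j < scale k)%N &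
        W (s + 2^-1 ^+ (n.+1 * scale k + j)) x - W s x < - drop_depth H sigma n.+1 k]}.
  apply: ae_foralln => n.
  exact: (fbm_ae_good W_fbm H_gt0 H_lt1 sigma_gt0 W_cont (isT : (0 < n.+1)%N)).
move: W_cont dyadic good; apply: filterS3 => x wc dyadic good.
exists wc.
have upper : (variation_index (fun t => W t x) <= (1 / H)%:E)%E.
  apply/lee_addgt0Pr => e e0.
  pose n := Num.bound (H * e)^-1.
  have [n0 hn0] := dyadic n.
  have [C C0 hC] := eventual_dyadic_holder (al_gt0 n) wc hn0.
  have al1 : al n <= 1 by exact: ltW (lt_trans (al_lt n) H_lt1).
  apply: le_trans (variation_index_holder C0 (al_gt0 n) al1 hC) _.
  rewrite -EFinD lee_fin /al.
  have -> : (H * (n.+1%:R / n.+2%:R))^-1 = 1 / H + (H * n.+1%:R)^-1.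
    rewrite -[n.+2%:R]natr1; have : 0 < n.+1%:R :> R by rewrite ltr0n.
    by move: n.+1%:R => b b0; field; rewrite !gt_eqF// addr_gt0.
  rewrite lerD2l invfM -ler_pdivlMl ?invr_gt0// invrK.
  rewrite -[leRHS]invrK lef_pV2 ?posrE ?invr_gt0 ?mulr_gt0 ?ltr0n//.
  apply: ltW; apply: lt_le_trans (archi_boundP _) _.
    by rewrite invr_ge0 mulr_ge0 ?ltW.
  by rewrite ler_nat.
have lower : ((1 / H)%:E <= hausdorff_dim [set: tree wc])%E.
  apply/lee_addgt0Pr => e e0; rewrite -leeBlDr// -EFinB.
  pose n := Num.bound (2 * (H * e)^-1).
  have [G [i [mG G01 G0 Gdrop]]] := good n.
  (* With [a = n.+1] the exponent must stay below [n.+1 / (H n.+2)]; the denominator [n.+3] makes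
     this strict, and [1 / H - gam = 2 / (H n.+3)] tends to 0. *)
  pose gam := n.+1%:R / (H * n.+3%:R).
  apply: (@le_trans _ _ gam%:E).
    rewrite lee_fin lerBlDr.
    have -> : 1 / H = gam + 2 * (H * n.+3%:R)^-1.
      rewrite /gam -[n.+3%:R]natr1 -[n.+2%:R]natr1.
      have : 0 < n.+1%:R :> R by rewrite ltr0n.
      move: n.+1%:R => b b0; field; rewrite !gt_eqF//; lra.
    rewrite lerD2l invfM mulrCA -ler_pdivlMl ?invr_gt0// invrK.
    rewrite ler_pdivrMr ?ltr0n// -ler_pdivrMl ?mulr_gt0// mulrC.
    apply: ltW; apply: lt_le_trans (archi_boundP _) _.
      by rewrite mulr_ge0 ?invr_ge0 ?mulr_ge0 ?ltW.
    by rewrite ler_nat (leq_trans (leqnSn _))// ltnW// ltnW.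
  apply: (tree_dim_ge_good wc H_gt0 sigma_gt0 _ mG G01 G0 Gdrop) => //.
    by rewrite divr_gt0 ?mulr_gt0 ?ltr0n.
  have -> : gam * H * n.+2%:R = n.+1%:R * (n.+2%:R / n.+3%:R).
    rewrite /gam; have : 0 < n.+3%:R :> R by rewrite ltr0n.
    by move: n.+3%:R => b b0; field; rewrite !gt_eqF.
  by rewrite -[ltRHS]mulr1 ltr_pM2l ?ltr0n// ltr_pdivrMr ?ltr0n// mul1r ltr_nat.
have mid := tree_dim_le_variation_index wc.
have VE : variation_index (fun t => W t x) = (1 / H)%:E.
  by apply/eqP; rewrite eq_le upper (le_trans lower mid).
split=> //; apply/eqP; rewrite eq_le mid VE; exact: lower.
Qed.
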